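(* Consider the $\omega$-periodic homogeneous linear impulsive differential system with piecewise constant argument of generalized type $$(S)\qquad x'(t)=A(t)x(t)+B(t)x(\gamma(t)),\quad t\neq t_k;\qquad \Delta x|_{t=t_k}=C_kx(t_k^-),\quad t=t_k,$$ and let the periodicity conditions, hypothesis (H), the biperiodicity property, the factorization $X(t+\omega)=X(t)X(\omega)$ of the fundamental solution $X(t)$ with $X(0)=I$, and condition (L), all given in the context, hold. Then: (i) The solution $X(t)$ of $(S)$ can be represented in the Floquet normal form $$X(t)=Q(t)\exp(Pt),\qquad P=\frac1\omega\,\mathrm{Log}(X(\omega)),\qquad t\in\mathbb{R},$$ where $P\in\mathbb{C}^{n\times n}$ is constant and the matrix function $Q(t)\in\mathcal{PC}^1(\mathbb{R},\mathbb{C}^{n\times n})$ is non-singular, $\omega$-periodic and satisfies the impulsive equation $$Q'(t)=A(t)Q(t)-Q(t)P+B(t)Q(\gamma(t))e^{P(\gamma(t)-t)},\quad t\neq t_k,$$ $$Q(t_k)=(I+C_k)Q(t_k^-),\quad t=t_k.$$ Also, if $A(t)$, $B(t)$ and $C_k$ are real matrices, each fundamental solution $X(t)$ of $(S)$ can be represented in the Floquet normal form $$X(t)=\tilde Q(t)\exp(\tilde Pt),\qquad \tilde P=\frac1{2\omega}\,\mathrm{Log}(X^2(\omega)),\qquad t\in\mathbb{R},$$ where $\tilde P\in\mathbb{R}^{n\times n}$ is constant and $\tilde Q(t)\in\mathcal{PC}^1(\mathbb{R},\mathbb{R}^{n\times n})$ is a non-singular $2\omega$-periodic matrix function. (ii)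 The system $(S)$ is reducible to the ordinary differential equation $$Y'(t)=PY(t)$$ by an $\omega$-periodic Floquet–Lyapunov transformation $X(t)=Q(t)Y(t)$. That is, $(S)$ and $Y'(t)=PY(t)$ are IDEPCAG-kinematically similar by the use of the Lyapunov function $Q(t)$, which verifies the differential equation with piecewise constant argument $$Q'(t)=A(t)Q(t)-Q(t)P+B(t)Q(\gamma(t))e^{P(\gamma(t)-t)}.$$
   Context: Setting. $\omega>0$; $(t_k)_{k\in\mathbb{Z}}$ and $(\zeta_k)_{k\in\mathbb{Z}}$ are real sequences with $t_k<t_{k+1}$, $t_k\to\pm\infty$ as $k\to\pm\infty$, and $t_k\le\zeta_k\le t_{k+1}$; $\gamma(t)=\zeta_k$ for $t\in I_k=[t_k,t_{k+1})$. $A(t),B(t)$ are $n\times n$ real-valued, locally integrable, continuous matrix functions (piecewise continuous with jump discontinuities at $t=t_k$). $(C_k)$ are real $n\times n$ matrices, and there is a natural number $p$ such that $\det(I+C_k)\neq0$ for $k=1,\dots,p$, where $I$ is the identity matrix. The initial time is $t_0=0$, and $t_0=0<t_1<\dots<t_p\le\omega$. Periodicity conditions: $A(t+\omega)=A(t)$ and $B(t+\omega)=B(t)$ for all $t\in[0,\infty)$; $C_{k+p}=C_k$ for all $k\in\mathbb{Z}$; and $t_{k+p}=t_k+\omega$, $\zeta_{k+p}=\zeta_k+\omega$ for all $k\in\mathbb{Z}$. Hypothesis (H): with $|\cdot|$ some matrix norm and $M\in\{A,B\}$, put $\sigma_k^+(M)=\exp\left(\int_{t_k}^{\zeta_k}|M(u)|\,du\right)$,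 $\sigma_k^-(M)=\exp\left(\int_{\zeta_k}^{t_{k+1}}|M(u)|\,du\right)$, $\sigma_k(A)=\sigma_k^+(A)\sigma_k^-(A)$, $\nu_k^\pm(B)=\sigma_k^\pm(A)\ln\sigma_k^\pm(B)$. Assume $\sup_{k\in\mathbb{Z}}\sigma_k(A)<\infty$ and $\nu_k^\pm(B)\le\nu^\pm(B):=\sup_{k\in\mathbb{Z}}\nu_k^\pm(B)<1$. Matrices and biperiodicity. $\Phi(t)$ is the fundamental matrix of $Z'(t)=A(t)Z(t)$ with $\Phi(0)=I$; $\Phi(t,s)=\Phi(t)\Phi^{-1}(s)$, $J(t,s)=I+\int_s^t\Phi(s,u)B(u)\,du$, $E(t,s)=\Phi(t,s)J(t,s)$. The biperiodicity property is: $\Phi(t+\omega,s+\omega)=\Phi(t,s)$, $J(t+\omega,s+\omega)=J(t,s)$, $E(t+\omega,s+\omega)=E(t,s)$ for all $t,s\in\mathbb{R}$. Solutions. $\Delta x|_{t=t_k}=x(t_k)-x(t_k^-)$, where $x(t_k^-)$ is the left-hand limit. A solution of $(S)$ is a piecewise continuous function, continuous on each $I_k$ with jump discontinuities at the $t_k$, differentiable except possibly at the $t_k$, where lateral derivatives exist, such that $x'(t)=A(t)x(t)+B(t)x(\zeta_k)$ on each $I_k$ and $x(t_k)=(I+C_k)x(t_k^-)$. A fundamental solution (fundamental matrix) is a non-singular matrix solution. Monodromy matrix and (L). For the fundamental solution with $X(0)=I$, the monodromy matrix is $X(\omega)=\prod_{r=1}^p(I+C_r)E(t_r,\zeta_{r-1})E(t_{r-1},\zeta_{r-1})^{-1}$,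 with products ordered with the largest index on the left. Condition (L): $\det X(\omega)\neq0$, so that $\mathrm{Log}(X(\omega))$ exists. Logarithm. For a complex nonsingular matrix $M$, $\mathrm{Log}(M)$ is a matrix $C$, possibly complex, with $\exp(C)=M$; for a real nonsingular $M$, $\mathrm{Log}(M^2)$ is a real matrix $C$ with $\exp(C)=M^2$. Such logarithms exist. Function classes. $\mathcal{PC}(\mathbb{R},V)$ is the set of functions $\mathbb{R}\to V$ that are continuous for $t\neq t_k$ and continuous from the right with jump discontinuities at $t=t_k$; $\mathcal{PC}^1(\mathbb{R},V)$ is the set of functions $s:\mathbb{R}\to V$ with $s'\in\mathcal{PC}(\mathbb{R},V)$. Terminology. $(S)$ is reducible to $Y'=PY$ by $X=Q(t)Y$ if this non-singular linear change of variables transforms $(S)$ into $Y'=PY$. The two systems are IDEPCAG-kinematically similar if there is a Lyapunov function $Q(t)$ (invertible, bounded, and differentiable except possibly at the $t_k$) satisfying the last displayed equation for $Q$.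
   Formalization: In the real part of (i), for a fundamental solution X with X(0) ≠ I, Log(X²(ω)) is replaced by Log((X(0)^{-1}X(ω))²); the literal formula fails, e.g. for A=B=C_k=0, X=2I. For X(0)=I it is unchanged. *)

(* Defs.v *)
From mathcomp Require Import all_boot all_order all_algebra.
From mathcomp Require Import all_classical all_reals all_analysis.
From mathcomp Require Import complex.

Set Implicit Arguments.
Unset Strict Implicit.
Unset Printing Implicit Defensive.

Import Order.TTheory GRing.Theory Num.Theory.
Import numFieldNormedType.Exports.

Local Open Scope classical_set_scope.
Local Open Scope ring_scope.

Definition expmx (K : numFieldType) (n : nat) (M : 'M[K]_n) : 'M[K]_n :=
  limn (series (fun k : nat => (k`!%:R)^-1 *: M ^+ k)).

Definition is_mxlog (K : numFieldType) (n : nat) (M L : 'M[K]_n) : Prop :=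
  expmx L = M.

Record is_matrix_norm (R : realType) (n : nat) (N : 'M[R]_n -> R) : Prop := {
  mxnorm_ge0 : forall M, 0 <= N M ;
  mxnorm_eq0 : forall M, N M = 0 -> M = 0 ;
  mxnormZ : forall a M, N (a *: M) = `|a| * N M ;
  mxnormD : forall M M', N (M + M') <= N M + N M' ;
  mxnormM : forall M M', N (M *m M') <= N M * N M' }.

Definition cmx (R : realType) (m n : nat) (M : 'M[R]_(m, n)) : 'M[R[i]]_(m, n) :=
  map_mx (real_complex R) M.

(* \int_a^b f, with the usual sign when b < a. *)
Definition oint (R : realType) (a b : R) (f : R -> R) : R :=
  if a <= b then \int[lebesgue_measure]_(u in `[a, b]) f u
  else - \int[lebesgue_measure]_(u in `[b, a]) f u.

Definition oint_mx (R : realType) (n : nat) (a b : R) (F : R -> 'M[R]_n) :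
  'M[R]_n := \matrix_(i, j) oint a b (fun u => F u i j).

(* Functions of a real variable valued in matrices over [K], where [K] is
   either [R] (with [emb] the identity) or [R[i]] (with [emb] the inclusion):
   the library has no derivative along [R] for values in an [R[i]]-module. *)
Section MatrixFunctions.
Variables (R : realType) (K : numFieldType) (emb : R -> K).
Variables (tk : int -> R) (m n : nat).
Implicit Types x dx : R -> 'M[K]_(m, n).

Definition off_grid (t : R) : Prop := forall k : int, t <> tk k.

Definition left_lim x (t : R) : 'M[K]_(m, n) := lim (x @ t^'-).

Definition diff_quot x (a : 'M[K]_(m, n)) (t h : R) : 'M[K]_(m, n) :=
  (emb h)^-1 *: (x (t + h) - a).

Definition has_deriv x (t : R) (d : 'M[K]_(m, n)) : Prop :=
  diff_quot x (x t) t h @[h --> (0 : R)^'] --> d.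

Definition has_right_deriv x (t : R) (d : 'M[K]_(m, n)) : Prop :=
  diff_quot x (x t) t h @[h --> (0 : R)^'+] --> d.

(* The base point is the left limit: [x] may jump at [t]. *)
Definition has_left_deriv x (t : R) (d : 'M[K]_(m, n)) : Prop :=
  diff_quot x (left_lim x t) t h @[h --> (0 : R)^'-] --> d.

(* A jump is allowed, not required, at the grid points. *)
Definition PC x : Prop :=
  (forall t, off_grid t -> {for t, continuous x}) /\
  (forall k, x @ (tk k)^'+ --> x (tk k) /\ cvg (x @ (tk k)^'-)).

(* At a grid point the derivative is the right lateral one. *)
Definition pc_deriv x dx : Prop :=
  (forall t, off_grid t -> has_deriv x t (dx t)) /\
  (forall k, has_right_deriv x (tk k) (dx (tk k)) /\
             exists d, has_left_deriv x (tk k) d).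

Definition PC1 x : Prop := exists2 dx, pc_deriv x dx & PC dx.

End MatrixFunctions.

Lemma has_derivE (R : realType) (m n : nat) (x : R -> 'M[R]_(m, n)) t d :
  has_deriv idfun x t d <-> is_derive t (1 : R) x d.
Proof.
have E : diff_quot idfun x (x t) t =
    (fun h : R => h^-1 *: ((x \o shift t) (h *: (1 : R)) - x t)).
  by apply/funext => h; rewrite /diff_quot /= [t + h]addrC [h%:A]mulr1.
rewrite /has_deriv E; split=> [xd|[dx <-]]; last exact: dx.
by apply: DeriveDef; [apply: cvgP xd|exact: cvg_lim xd].
Qed.

Section System.
Variables (R : realType) (n : nat).
Variables (tk zeta : int -> R) (gamma : R -> R) (A B : R -> 'M[R]_n).
Variable C : int -> 'M[R]_n.

(* Real or complex, with any number of columns: vectors and matrices. *)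
Definition is_solution (K : numFieldType) (emb : R -> K) (m : nat)
    (x : R -> 'M[K]_(n, m)) : Prop :=
  [/\ PC tk x,
      pc_deriv emb tk x (fun t =>
        map_mx emb (A t) *m x t + map_mx emb (B t) *m x (gamma t)) &
      forall k, x (tk k) = map_mx emb (1%:M + C k) *m left_lim x (tk k)].

Definition is_fundamental (X : R -> 'M[R]_n) : Prop :=
  is_solution idfun X /\ forall t, X t \in unitmx.

(* [Phi' = A Phi] can fail at the grid points, where [A] may jump. *)
Definition is_transition (Phi : R -> 'M[R]_n) : Prop :=
  [/\ continuous Phi,
      forall t, off_grid tk t -> is_derive t (1 : R) Phi (A t *m Phi t),
      forall t, Phi t \in unitmx & Phi 0 = 1%:M].

Variable Phi : R -> 'M[R]_n.

Definition Phi2 (t s : R) : 'M[R]_n := Phi t *m invmx (Phi s).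

Definition Jmx (t s : R) : 'M[R]_n :=
  1%:M + oint_mx s t (fun u => Phi2 s u *m B u).

Definition Emx (t s : R) : 'M[R]_n := Phi2 t s *m Jmx t s.

Definition biperiodic (w : R) : Prop :=
  [/\ forall t s, Phi2 (t + w) (s + w) = Phi2 t s,
      forall t s, Jmx (t + w) (s + w) = Jmx t s &
      forall t s, Emx (t + w) (s + w) = Emx t s].

Definition deviation_grid : Prop :=
  [/\ forall k, tk k < tk (k + 1),
      tk k%:Z @[k --> \oo] --> +oo,
      tk (- k%:Z) @[k --> \oo] --> -oo,
      forall k, tk k <= zeta k <= tk (k + 1) &
      forall k t, tk k <= t < tk (k + 1) -> gamma t = zeta k].

Definition loc_integrable_mx (M : R -> 'M[R]_n) : Prop :=
  forall i j, locally_integrable setT (fun t => M t i j).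

Definition periodic_data (w : R) (p : nat) : Prop :=
  [/\ forall t, 0 <= t -> A (t + w) = A t,
      forall t, 0 <= t -> B (t + w) = B t,
      forall k, C (k + p%:Z) = C k,
      forall k, tk (k + p%:Z) = tk k + w &
      forall k, zeta (k + p%:Z) = zeta k + w].

Variable N : 'M[R]_n -> R.

Definition sigma_plus (M : R -> 'M[R]_n) (k : int) : R :=
  expR (oint (tk k) (zeta k) (fun u => N (M u))).

Definition sigma_minus (M : R -> 'M[R]_n) (k : int) : R :=
  expR (oint (zeta k) (tk (k + 1)) (fun u => N (M u))).

Definition nu_plus (k : int) : R := sigma_plus A k * ln (sigma_plus B k).
Definition nu_minus (k : int) : R := sigma_minus A k * ln (sigma_minus B k).

Definition hyp_H : Prop :=
  [/\ (ereal_sup (range (fun k => (sigma_plus A k * sigma_minus A k)%:E))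
        < +oo)%E,
      (ereal_sup (range (fun k => (nu_plus k)%:E)) < 1%:E)%E &
      (ereal_sup (range (fun k => (nu_minus k)%:E)) < 1%:E)%E].

End System.

Section Floquet.
Variables (R : realType) (n : nat).
Variables (tk : int -> R) (gamma : R -> R) (A B : R -> 'M[R]_n).
Variable C : int -> 'M[R]_n.

Definition Q_equation (P : 'M[R[i]]_n) (Q : R -> 'M[R[i]]_n) : Prop :=
  forall t, off_grid tk t ->
    has_deriv (real_complex R) Q t
      (cmx (A t) *m Q t - Q t *m P
       + cmx (B t) *m Q (gamma t)
           *m expmx (real_complex R (gamma t - t) *: P)).

Definition Q_impulse (Q : R -> 'M[R[i]]_n) : Prop :=
  forall k, Q (tk k) = cmx (1%:M + C k) *m left_lim Q (tk k).

Definition complex_floquet_form (w : R) (X : R -> 'M[R]_n)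
    (P : 'M[R[i]]_n) (Q : R -> 'M[R[i]]_n) : Prop :=
  (forall t, cmx (X t) = Q t *m expmx (real_complex R t *: P)) /\
  [/\ PC1 (real_complex R) tk Q,
      forall t, Q t \in unitmx,
      forall t, Q (t + w) = Q t,
      Q_equation P Q &
      Q_impulse Q].

(* [M] is the monodromy matrix [X(0)^-1 X(w)], i.e. [X(w)] when [X(0) = I]; every
   real logarithm of [M^2] is admitted as Log(M^2), and one exists. *)
Definition real_floquet_form (w : R) (X : R -> 'M[R]_n) (M : 'M[R]_n) : Prop :=
  (exists L : 'M[R]_n, is_mxlog (M *m M) L) /\
  forall L : 'M[R]_n, is_mxlog (M *m M) L ->
    let P := (2 * w)^-1 *: L in
    exists Q : R -> 'M[R]_n,
      [/\ forall t, X t = Q t *m expmx (t *: P),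
          PC1 idfun tk Q,
          forall t, Q t \in unitmx &
          forall t, Q (t + 2 * w) = Q t].

Definition reducible_by (P : 'M[R[i]]_n) (Q : R -> 'M[R[i]]_n) : Prop :=
  (forall t, Q t \in unitmx) /\
  forall (m : nat) (Y : R -> 'M[R[i]]_(n, m)),
    is_solution tk gamma A B C (real_complex R) (fun t => Q t *m Y t) <->
    forall t, has_deriv (real_complex R) Y t (P *m Y t).

Definition lyapunov_function (Q : R -> 'M[R[i]]_n) : Prop :=
  [/\ forall t, Q t \in unitmx,
      exists K : R, forall t i j, `|Q t i j| <= real_complex R K &
      forall t, off_grid tk t -> exists d, has_deriv (real_complex R) Q t d].

Definition kinematically_similar_by (P : 'M[R[i]]_n) (Q : R -> 'M[R[i]]_n) :
  Prop := lyapunov_function Q /\ Q_equation P Q.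

End Floquet.

(* Main.v *)
Require Import Defs.
From mathcomp Require Import all_boot all_order all_algebra.
From mathcomp Require Import all_classical all_reals all_analysis.
From mathcomp Require Import complex ring lra.

Set Implicit Arguments.
Unset Strict Implicit.
Unset Printing Implicit Defensive.

Import Order.TTheory GRing.Theory Num.Theory.
Import numFieldNormedType.Exports.

Local Open Scope classical_set_scope.
Local Open Scope ring_scope.

(** The normal forms and the reduction to [Y' = P Y] rest on two facts: the
    monodromy matrix [X w] has a logarithm, and every solution of the impulsive
    system is [X c] for a constant [c].

    Given a logarithm [L] of the monodromy matrix and [P := L / w], the matrix
    [Q t := X t * exp (- t P)] is periodic, because [exp (- w P)] cancels the factor
    [X w] by which [X] is multiplied over one period.  Its differential equation and
    its impulses are those of [X], by the product rule and because
    [X (gamma t) exp (- t P) = Q (gamma t) exp ((gamma t - t) P)].  It is bounded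
    since it is periodic and has one-sided limits ([PC_periodic_bounded]).  In the
    real case the same construction is applied over two periods, where the solution
    is multiplied by the square of the monodromy matrix.

    Logarithms are found by continuation.  For [N := M - 1], the determinant of
    [1 + z N] vanishes for finitely many [z] only, none of them equal to [0] or [1];
    an arc of parabola from [0] to [1] avoids them, and the integral [L] of
    [(1 + z N)^-1 N dz] along it satisfies [exp L = M], because all the matrices
    involved commute and [exp (- L) (1 + z N)] has derivative zero
    ([log_along_path], [complex_logarithm]).  Moreover [L] commutes with all that
    commutes with [M].  If [M] is real, the conjugate of [L] is another logarithm of
    [M], it commutes with [L], and [L + conj L] is a real logarithm of [M ^ 2]
    ([real_logarithm_sqr]).

    Uniqueness ([solutionE]) is what makes the change of variables [x = Q Y] an
    equivalence between the system and [Y' = P Y], and what reduces an arbitrary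
    fundamental solution to [X].  On an interval of the grid, subtract from a
    solution the multiple of [X] with the same value at the deviation point; the
    difference solves [u' = A u] and vanishes at that point, so it is zero.  When
    the deviation point is the right end of the interval, the value there is taken
    after the impulse, but the impulses are injective by periodicity.  The impulses
    also carry the constant from one interval to the next one.

    All this is done over a field [K] which is [R] or [R[i]], with derivatives along
    [R]: elements of [K] have real coordinates, which reduces limits, derivatives
    and antiderivatives to real ones ([real_coordinates]). *)

(** * Limits of matrix-valued functions *)

Section Limits.
Variables (K : numFieldType) (T : Type) (F : set_system T).
Context {FF : Filter F}.

Lemma cvg_eq_near (U : topologicalType) (f g : T -> U) (l : U) :
  (\near F, f F = g F) -> f @ F --> l -> g @ F --> l.
Proof. by move=> fg; apply: cvg_trans; exact: near_eq_cvg. Qed.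

Lemma cvg_mxP m n (f : T -> 'M[K]_(m, n)) (M : 'M[K]_(m, n)) :
  f @ F --> M <-> forall i j, f t i j @[t --> F] --> M i j.
Proof.
split=> [fM i j|fM].
  apply: (cvg_comp f (fun N : 'M[K]_(m, n) => N i j) fM).
  exact: coord_continuous.
move=> A [P MP PA].
suff : \near F, forall i j, P i j (f F i j) by apply: filterS => t Pt; exact: PA.
by apply: filter_forall => i; apply: filter_forall => j; exact/fM/MP.
Qed.

Lemma cvg_sumr I (r : seq I) (P : pred I) (f : I -> T -> K) (a : I -> K) :
  (forall i, P i -> f i @ F --> a i) ->
  \sum_(i <- r | P i) f i t @[t --> F] --> \sum_(i <- r | P i) a i.
Proof. by move=> fa; apply: cvg_big => //; exact: add_continuous. Qed.

Lemma cvg_prodr I (r : seq I) (P : pred I) (f : I -> T -> K) (a : I -> K) :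
  (forall i, P i -> f i @ F --> a i) ->
  \prod_(i <- r | P i) f i t @[t --> F] --> \prod_(i <- r | P i) a i.
Proof. by move=> fa; apply: cvg_big => //; exact: mul_continuous. Qed.

Lemma cvg_mulmx m n q (f : T -> 'M[K]_(m, n)) (g : T -> 'M[K]_(n, q))
    (M : 'M[K]_(m, n)) (N : 'M[K]_(n, q)) :
  f @ F --> M -> g @ F --> N -> f t *m g t @[t --> F] --> M *m N.
Proof.
move=> /cvg_mxP fM /cvg_mxP gN; apply/cvg_mxP => i j; rewrite mxE.
under eq_cvg do rewrite mxE.
by apply: cvg_sumr => k _; exact: cvgM.
Qed.

Lemma cvg_det n (f : T -> 'M[K]_n) (M : 'M[K]_n) :
  f @ F --> M -> \det (f t) @[t --> F] --> \det M.
Proof.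
move=> /cvg_mxP fM; apply: cvg_sumr => s _.
by apply: cvgM; [exact: cvg_cst|exact: cvg_prodr].
Qed.

Lemma cvg_invmx n (f : T -> 'M[K]_n) (M : 'M[K]_n) : (forall t, f t \in unitmx) ->
  M \in unitmx -> f @ F --> M -> invmx (f t) @[t --> F] --> invmx M.
Proof.
move=> fu Mu fM; apply/cvg_mxP => i j; rewrite /invmx Mu !mxE.
under eq_cvg do rewrite fu !mxE.
apply: cvgM.
  by apply: cvgV; [rewrite -unitfE -unitmxE|exact: cvg_det].
apply: cvgM; first exact: cvg_cst.
apply: cvg_det; apply/cvg_mxP => k l; rewrite !mxE.
by under eq_cvg do rewrite !mxE; move/cvg_mxP: fM; exact.
Qed.

End Limits.

(** * The scalar fields *)

(** Common description of [R] over itself and of [R[i]] over [R]: a scalar is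
    given by two real coordinates (for [K := R] the second one is [0]), and its
    absolute value is a real number.  Limits and derivatives in [K] are thus
    reduced to real ones, and the real and complex cases treated at once. *)
Record real_coordinates (R : realType) (K : numFieldType)
    (emb : {rmorphism R -> K}) := RealCoordinates {
  cre : K -> R ;
  cim : K -> R ;
  cunit : K ;
  absr : K -> R ;
  coordE : forall z, z = emb (cre z) + cunit * emb (cim z) ;
  creD : forall z z', cre (z + z') = cre z + cre z' ;
  cimD : forall z z', cim (z + z') = cim z + cim z' ;
  creM : forall a z, cre (emb a * z) = a * cre z ;
  cimM : forall a z, cim (emb a * z) = a * cim z ;
  absrE : forall z, `|z| = emb (absr z) ;
  cre_le : forall z, `|cre z| <= absr z ;
  cim_le : forall z, `|cim z| <= absr z ;
  norm_emb : forall a, `|emb a| = emb `|a| }.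

Definition self_coordinates (R : realType) :
  real_coordinates (@idfun R : {rmorphism R -> R}).
Proof.
exists idfun (fun=> 0) 0 (fun z => `|z|) => //= *; rewrite ?mulr0 ?addr0//.
by rewrite normr0.
Defined.

Definition complex_coordinates (R : realType) :
  real_coordinates (real_complex R : {rmorphism R -> R[i]}).
Proof.
exists (@complex.Re R) (@complex.Im R) 'i%C (@Normc.normc R) => //=.
- exact: complexE.
- by case=> a b [].
- by case=> a b [].
- by move=> a [b c] /=; rewrite mul0r subr0.
- by move=> a [b c] /=; rewrite mul0r addr0.
- by case=> a b /=; rewrite -sqrtr_sqr ler_wsqrtr// lerDl sqr_ge0.
- by case=> a b /=; rewrite -sqrtr_sqr ler_wsqrtr// lerDr sqr_ge0.
- by move=> a; rewrite normc_def /= expr0n addr0 sqrtr_sqr.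
Defined.

Section ScalarField.
Variables (R : realType) (K : numFieldType) (emb : {rmorphism R -> K}).
Variable co : real_coordinates emb.

Lemma emb_ge0 a : 0 <= a -> 0 <= emb a.
Proof. by move=> a0; rewrite -(ger0_norm a0) -(norm_emb co) normr_ge0. Qed.

Lemma ler_emb a b : (emb a <= emb b) = (a <= b).
Proof.
apply/idP/idP => [|ab]; last by rewrite -subr_ge0 -rmorphB emb_ge0 ?subr_ge0.
move=> ab; case: leP => // ba.
have : emb b <= emb a by rewrite -subr_ge0 -rmorphB emb_ge0 ?subr_ge0 ?ltW.
by move=> /(conj ab)/andP/le_anti/fmorph_inj ab'; rewrite ab' ltxx in ba.
Qed.

Lemma ltr_emb a b : (emb a < emb b) = (a < b).
Proof. by rewrite !lt_neqAle ler_emb fmorph_eq. Qed.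

Lemma absr_ge0 z : 0 <= absr co z.
Proof. by rewrite -ler_emb rmorph0 -absrE. Qed.

(** A positive element of [K] equals its absolute value, hence is the image of a
    real number: real estimates are enough to prove limits in [K]. *)
Lemma cvg_dominated (T : Type) (F : set_system T) {FF : Filter F}
    (f : T -> K) (l : K) (g : T -> R) :
  (\near F, `|f F - l| <= emb (g F)) -> g @ F --> 0 -> f @ F --> l.
Proof.
move=> fg g0; apply/cvgrPdist_lt => e e0.
have e'0 : 0 < absr co e.
  by rewrite -ltr_emb -absrE rmorph0 gtr0_norm.
near=> t; rewrite -normrN opprB (le_lt_trans (near fg t _))//.
rewrite -[ltRHS]gtr0_norm// (absrE co) ltr_emb (le_lt_trans (ler_norm _))//.
by rewrite -normrN -[- _]add0r; near: t; exact: cvgr_dist_lt.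
Unshelve. all: by end_near. Qed.

Lemma cvg_emb (T : Type) (F : set_system T) {FF : Filter F} (f : T -> R) (a : R) :
  f @ F --> a -> emb (f t) @[t --> F] --> emb a.
Proof.
move=> fa; apply: (@cvg_dominated _ _ _ _ _ (fun t => `|f t - a|)).
  by apply: nearW => t; rewrite -rmorphB (norm_emb co).
rewrite -(normr0 R); apply: cvg_norm; rewrite -(subrr a).
by apply: cvgB => //; exact: cvg_cst.
Qed.

Lemma creB z z' : cre co (z - z') = cre co z - cre co z'.
Proof. by rewrite creD -[- z']mulN1r -[-1](rmorphN1 emb) creM mulN1r. Qed.

Lemma cimB z z' : cim co (z - z') = cim co z - cim co z'.
Proof. by rewrite cimD -[- z']mulN1r -[-1](rmorphN1 emb) cimM mulN1r. Qed.

Lemma cvg_cre (T : Type) (F : set_system T) {FF : Filter F} (f : T -> K) (l : K) :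
  f @ F --> l -> cre co (f t) @[t --> F] --> cre co l.
Proof.
move=> fl; apply/cvgrPdist_lt => e e0; near=> t.
rewrite -creB (le_lt_trans (cre_le _ _))// -ltr_emb -absrE.
by near: t; apply: cvgr_dist_lt => //; rewrite -(rmorph0 emb) ltr_emb.
Unshelve. all: by end_near. Qed.

Lemma cvg_cim (T : Type) (F : set_system T) {FF : Filter F} (f : T -> K) (l : K) :
  f @ F --> l -> cim co (f t) @[t --> F] --> cim co l.
Proof.
move=> fl; apply/cvgrPdist_lt => e e0; near=> t.
rewrite -cimB (le_lt_trans (cim_le _ _))// -ltr_emb -absrE.
by near: t; apply: cvgr_dist_lt => //; rewrite -(rmorph0 emb) ltr_emb.
Unshelve. all: by end_near. Qed.

Lemma cvg_coord (T : Type) (F : set_system T) {FF : Filter F} (f : T -> K) a b :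
  cre co (f t) @[t --> F] --> a -> cim co (f t) @[t --> F] --> b ->
  f @ F --> emb a + cunit co * emb b.
Proof.
move=> fa fb; under eq_cvg do rewrite (coordE co (f _)).
by apply: cvgD; [|apply: cvgM; first exact: cvg_cst]; exact: cvg_emb.
Qed.

Lemma cvg_series_dominated (u : nat -> K) (c : nat -> R) :
  (forall k, `|u k| <= emb (c k)) -> cvgn (series c) -> cvgn (series u).
Proof.
move=> uc sc.
have absu k : absr co (u k) <= c k by rewrite -ler_emb -absrE.
have dom (v : nat -> R) : (forall k, `|v k| <= absr co (u k)) -> cvgn (series v).
  move=> vu; apply: normed_cvg; apply: (series_le_cvg _ _ _ sc) => k //=.
    by rewrite (le_trans _ (absu k))// absr_ge0.
  exact: le_trans (absu k).
have crS N : cre co (series u N) = series (fun k => cre co (u k)) N.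
  rewrite /series /=; elim: N => [|N IH].
    by rewrite !big_geq// -(subrr 0) creB subrr.
  by rewrite !big_nat_recr//= creD IH.
have ciS N : cim co (series u N) = series (fun k => cim co (u k)) N.
  rewrite /series /=; elim: N => [|N IH].
    by rewrite !big_geq// -(subrr 0) cimB subrr.
  by rewrite !big_nat_recr//= cimD IH.
have /cvg_ex [a sa] := dom _ (fun k => cre_le co (u k)).
have /cvg_ex [b sb] := dom _ (fun k => cim_le co (u k)).
apply/cvg_ex; exists (emb a + cunit co * emb b); apply: cvg_coord.
  by under eq_cvg do rewrite crS.
by under eq_cvg do rewrite ciS.
Qed.

End ScalarField.

Section RowBounds.
Variables (R : realType) (K : numFieldType) (emb : {rmorphism R -> K}).
Variable co : real_coordinates emb.

Lemma norm_lim_le (T : Type) (F : set_system T) {FF : ProperFilter F}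
    (f : T -> K) (l : K) (c : R) :
  f @ F --> l -> (\near F, `|f F| <= emb c) -> `|l| <= emb c.
Proof.
move=> fl fc; rewrite (absrE co) (ler_emb co); apply/ler_addgt0Pr => e e0.
rewrite -(ler_emb co) -absrE rmorphD.
have e'0 : 0 < emb e by rewrite -(rmorph0 emb) (ltr_emb co).
near F => t; have -> : l = f t + (l - f t) by rewrite addrC subrK.
rewrite (le_trans (ler_normD _ _))// lerD//; first by near: t.
by apply: ltW; near: t; exact: cvgr_dist_lt.
Unshelve. all: by end_near. Qed.

Variable n : nat.
Implicit Types (A B M : 'M[K]_n) (c d : R).

(** The maximal row sum is a submultiplicative norm for which the identity has
    norm [1]; stating the bound instead of the norm keeps it in [R]. *)
Definition row_bounded c M := forall i, \sum_j `|M i j| <= emb c.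

Lemma row_bounded_entry c M i j : row_bounded c M -> `|M i j| <= emb c.
Proof.
move=> /(_ i); apply: le_trans; rewrite (bigD1 j)//= lerDl.
by rewrite sumr_ge0.
Qed.

Lemma row_bounded_ge0 c M (i : 'I_n) : row_bounded c M -> 0 <= emb c.
Proof. by move=> /(_ i); apply: le_trans; rewrite sumr_ge0. Qed.

Lemma row_bounded_le c d M : c <= d -> row_bounded c M -> row_bounded d M.
Proof. by move=> cd Mc i; rewrite (le_trans (Mc i))// (ler_emb co). Qed.

Lemma row_bounded0 : row_bounded 0 0.
Proof.
by move=> i; rewrite rmorph0 big1// => j _; rewrite mxE normr0.
Qed.

Lemma row_bounded1 : row_bounded 1 1%:M.
Proof.
move=> i; rewrite rmorph1 (bigD1 i)//= mxE eqxx normr1 big1 ?addr0// => j ji.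
by rewrite mxE eq_sym (negbTE ji) normr0.
Qed.

Lemma row_boundedD c d A B :
  row_bounded c A -> row_bounded d B -> row_bounded (c + d) (A + B).
Proof.
move=> Ac Bd i; rewrite rmorphD (le_trans _ (lerD (Ac i) (Bd i)))//.
rewrite -big_split; apply: ler_sum => j _; rewrite mxE; exact: ler_normD.
Qed.

Lemma row_bounded_sum (I : Type) (r : seq I) (P : pred I) (c : I -> R)
    (A : I -> 'M[K]_n) : (forall i, P i -> row_bounded (c i) (A i)) ->
  row_bounded (\sum_(i <- r | P i) c i) (\sum_(i <- r | P i) A i).
Proof.
move=> Ac; elim/big_rec2: _ => [|i d B Pi Bd]; first exact: row_bounded0.
exact: row_boundedD (Ac i Pi) Bd.
Qed.

Lemma row_boundedZ a c M : 0 <= a -> row_bounded c M ->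
  row_bounded (a * c) (emb a *: M).
Proof.
move=> a0 Mc i; rewrite rmorphM (le_trans _ (ler_wpM2l (emb_ge0 co a0) (Mc i)))//.
rewrite mulr_sumr; apply: ler_sum => j _.
by rewrite mxE normrM (norm_emb co) (ger0_norm a0).
Qed.

Lemma row_boundedM c d A B :
  row_bounded c A -> row_bounded d B -> row_bounded (c * d) (A *m B).
Proof.
move=> Ac Bd i; rewrite rmorphM.
rewrite (le_trans _ (ler_wpM2r (row_bounded_ge0 i Bd) (Ac i)))// mulr_suml.
rewrite (@le_trans _ _ (\sum_j \sum_k `|A i k| * `|B k j|))//.
  apply: ler_sum => j _; rewrite mxE (le_trans (ler_norm_sum _ _ _))//.
  by apply: ler_sum => k _; rewrite normrM.
rewrite exchange_big; apply: ler_sum => k _; rewrite -mulr_sumr.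
by rewrite ler_wpM2l.
Qed.

Lemma row_boundedX c M k : row_bounded c M -> row_bounded (c ^+ k) (M ^+ k).
Proof.
move=> Mc; elim: k => [|k IH]; first by rewrite !expr0; exact: row_bounded1.
by rewrite !exprS; exact: row_boundedM.
Qed.

Lemma row_bounded_ex M : exists2 c, 0 <= c & row_bounded c M.
Proof.
exists (\sum_i \sum_j absr co (M i j)).
  by apply: sumr_ge0 => i _; apply: sumr_ge0 => j _; exact: absr_ge0.
move=> i; rewrite rmorph_sum [leRHS](bigD1 i)//= ler_wpDr//.
  apply: sumr_ge0 => k _; apply: (emb_ge0 co); apply: sumr_ge0 => j _.
  exact: absr_ge0.
by rewrite rmorph_sum; apply: ler_sum => j _; rewrite -absrE.
Qed.

End RowBounds.

(** * The matrix exponential *)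

Section MatrixExponential.
Variables (R : realType) (K : numFieldType) (emb : {rmorphism R -> K}).
Variables (co : real_coordinates emb) (n : nat).
Implicit Types (A B D M T : 'M[K]_n).

Definition exp_term M (k : nat) : 'M[K]_n := (k`!%:R)^-1 *: M ^+ k.

Lemma row_bounded_exp_term c M k : row_bounded emb c M ->
  row_bounded emb (exp_coeff c k) (exp_term M k).
Proof.
move=> Mc; rewrite /exp_term /exp_coeff /= mulrC.
have -> : (k`!%:R^-1 : K) = emb k`!%:R^-1 by rewrite fmorphV rmorph_nat.
by apply: (row_boundedZ co); [rewrite invr_ge0|exact: row_boundedX].
Qed.

Lemma cvg_expmx M : series (exp_term M) @ \oo --> expmx M.
Proof.
suff : cvgn (series (exp_term M)) by [].
have [c c0 Mc] := row_bounded_ex co M.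
have sE N i j : (series (exp_term M) N) i j = series (fun k => exp_term M k i j) N.
  by rewrite /series /= summxE.
have sc i j : cvgn (series (fun k => exp_term M k i j)).
  apply: (cvg_series_dominated co _ (is_cvg_series_exp_coeff c)) => k.
  exact: row_bounded_entry (row_bounded_exp_term k Mc).
apply/cvg_ex; exists (\matrix_(i, j) limn (series (fun k => exp_term M k i j))).
apply/cvg_mxP => i j; rewrite mxE; under eq_cvg do rewrite sE.
exact: sc.
Qed.

Lemma sum_triangle (V : nmodType) (F : nat -> nat -> V) N :
  \sum_(0 <= k < N) \sum_(0 <= i < k.+1) F (k - i)%N i =
  \sum_(0 <= i < N) \sum_(0 <= j < N - i) F j i.
Proof.
elim: N => [|N IH]; first by rewrite !big_geq.
rewrite big_nat_recr//= IH [RHS]big_nat_recr//= subSnn big_nat1.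
rewrite [X in _ + X]big_nat_recr//= subnn addrA -big_split; congr (_ + _).
apply: eq_big_nat => i /andP[_ iN].
by rewrite subSn ?(ltnW iN)// big_nat_recr.
Qed.

(** The binomial formula in each degree, reindexed by the exponent of [B] so that
    the indices on the right can be compared with those of a product of two
    partial sums. *)
Lemma series_exp_termD A B N : A *m B = B *m A ->
  series (exp_term (A + B)) N =
  \sum_(0 <= i < N) \sum_(0 <= j < N - i) exp_term A j *m exp_term B i.
Proof.
move=> AB; rewrite /series /=.
have binomial k : exp_term (A + B) k =
    \sum_(0 <= i < k.+1) exp_term A (k - i) *m exp_term B i.
  rewrite /exp_term exprDn_comm// scaler_sumr big_mkord; apply: eq_bigr => i _.
  have ik : (i <= k)%N by rewrite -ltnS.
  rewrite -scalemxAl -scalemxAr.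
  rewrite scalerA -[_ *+ 'C(_, _)]scaler_nat scalerA; congr (_ *: _).
  rewrite -(bin_fact ik) !natrM !invfM [LHS]mulrC mulVKf; first exact: mulrC.
  by rewrite pnatr_eq0 -lt0n bin_gt0.
under eq_bigr do rewrite binomial.
exact: sum_triangle (fun j i => exp_term A j *m exp_term B i) N.
Qed.

(** The indices [i, j] with [i + j < 2 N] contain those with [i, j < N] and are
    contained in those with [i, j < 2 N].  The terms in between are majorized by
    tails of the real exponential series. *)
Lemma series_exp_termD_diff a b A B N :
  0 <= a -> 0 <= b -> row_bounded emb a A -> row_bounded emb b B ->
  A *m B = B *m A ->
  let s c := series (exp_coeff c) in
  row_bounded emb
    (s b N * (s a N.*2 - s a N) + (s b N.*2 - s b N) * s a N.*2)
    (series (exp_term (A + B)) N.*2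
     - series (exp_term A) N *m series (exp_term B) N).
Proof.
move=> a0 b0 Aa Bb AB s.
pose F j i := exp_term A j *m exp_term B i.
have FB j i : row_bounded emb (exp_coeff a j * exp_coeff b i) (F j i).
  by apply: row_boundedM; exact: row_bounded_exp_term.
have NN : (N <= N.*2)%N by rewrite -addnn leq_addl.
have prodE : series (exp_term A) N *m series (exp_term B) N =
    \sum_(0 <= i < N) \sum_(0 <= j < N) F j i.
  rewrite /series /= mulmx_sumr; apply: eq_bigr => i _.
  by rewrite mulmx_suml.
have split_rows : series (exp_term (A + B)) N.*2
     - series (exp_term A) N *m series (exp_term B) N =
   \sum_(0 <= i < N) \sum_(N <= j < N.*2 - i) F j i +
   \sum_(N <= i < N.*2) \sum_(0 <= j < N.*2 - i) F j i.
  rewrite series_exp_termD// prodE (@big_cat_nat _ _ _ N 0 N.*2)//= addrAC; congr (_ + _).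
  rewrite -sumrB; apply: eq_big_nat => i /andP[_ iN].
  rewrite (@big_cat_nat _ _ _ N 0 (N.*2 - i))//=.
    by rewrite addrAC subrr add0r.
  by rewrite -addnn -addnBA ?leq_addr// ltnW.
have tailE c : s c N.*2 - s c N = \sum_(N <= i < N.*2) exp_coeff c i.
  by rewrite /s sub_series_geq.
have coef0 c k : 0 <= c -> 0 <= exp_coeff c k by exact: exp_coeff_ge0.
rewrite split_rows; apply: row_boundedD; rewrite tailE.
  rewrite /s /series /= mulr_suml; apply: row_bounded_sum => i _.
  apply: (row_bounded_le co) (row_bounded_sum _ (fun j _ => FB j i)).
  rewrite -mulr_suml mulrC ler_wpM2l ?coef0//.
  case: (leqP N (N.*2 - i)) => Ni; last first.
    by rewrite (big_geq (ltnW Ni)) sumr_ge0// => j _; exact: coef0.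
  rewrite (@big_cat_nat _ _ _ (N.*2 - i)%N N N.*2) ?leq_subr//= lerDl.
  by rewrite sumr_ge0// => j _; exact: coef0.
rewrite mulr_suml; apply: row_bounded_sum => i _.
apply: (row_bounded_le co) (row_bounded_sum _ (fun j _ => FB j i)).
rewrite -mulr_suml mulrC ler_wpM2l ?coef0//.
rewrite /s /series /= (@big_cat_nat _ _ _ (N.*2 - i)%N 0 N.*2) ?leq_subr//= lerDl.
by rewrite sumr_ge0// => j _; exact: coef0.
Qed.

Lemma cvgn_double (T : topologicalType) (u : nat -> T) (l : T) :
  u @ \oo --> l -> u N.*2 @[N --> \oo] --> l.
Proof.
move=> ul; apply: (cvg_comp (fun N => N.*2) u _ ul).
move=> P [N _ NP]; exists N => // k Nk; apply: NP => /=.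
by rewrite (leq_trans Nk)// -addnn leq_addl.
Qed.

Lemma expmxD A B : A *m B = B *m A -> expmx (A + B) = expmx A *m expmx B.
Proof.
move=> AB.
have [a a0 Aa] := row_bounded_ex co A.
have [b b0 Bb] := row_bounded_ex co B.
have ca := is_cvg_series_exp_coeff a; have cb := is_cvg_series_exp_coeff b.
pose g N := series (exp_coeff b) N * (series (exp_coeff a) N.*2 - series (exp_coeff a) N)
  + (series (exp_coeff b) N.*2 - series (exp_coeff b) N) * series (exp_coeff a) N.*2.
have g0 : g @ \oo --> 0.
  rewrite (_ : 0 = expR b * (expR a - expR a) + (expR b - expR b) * expR a);
    last by rewrite !subrr mulr0 mul0r addr0.
  have eb := cb : series (exp_coeff b) @ \oo --> expR b.
  have ea := ca : series (exp_coeff a) @ \oo --> expR a.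
  apply: cvgD; apply: cvgM.
  - exact: eb.
  - by apply: cvgB; [exact: cvgn_double ea|exact: ea].
  - by apply: cvgB; [exact: cvgn_double eb|exact: eb].
  - exact: cvgn_double ea.
apply/eqP; rewrite -subr_eq0; apply/eqP.
have : (series (exp_term (A + B)) N.*2
     - series (exp_term A) N *m series (exp_term B) N) @[N --> \oo] -->
     expmx (A + B) - expmx A *m expmx B.
  apply: cvgB; first exact: cvgn_double (@cvg_expmx (A + B)).
  by apply: cvg_mulmx; exact: cvg_expmx.
move=> /cvg_lim <- //; apply: cvg_lim => //.
apply/cvg_mxP => i j; rewrite mxE.
apply: (cvg_dominated co _ g0); apply: nearW => N.
rewrite subr0; apply: row_bounded_entry.
exact: series_exp_termD_diff.
Qed.

(** The terms of degree at least [2] are majorized one by one by those of the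
    real exponential.  For [D = 0] this gives [expmx 0 = 1], and for small [D] the
    derivative of the exponential. *)
Lemma expmx_remainder d D i j : 0 <= d -> row_bounded emb d D ->
  `|(expmx D - 1%:M - D) i j| <= emb (expR d - 1 - d).
Proof.
move=> d0 Dd.
have cD : (series (exp_term D) (N + 2)%N - 1%:M - D) i j @[N --> \oo] -->
    (expmx D - 1%:M - D) i j.
  have : (series (exp_term D) (N + 2)%N - 1%:M - D) @[N --> \oo] -->
      (expmx D - 1%:M - D).
    apply: cvgB; last exact: cvg_cst.
    apply: cvgB; last exact: cvg_cst.
    by rewrite (cvg_shiftn 2 (series (exp_term D))); exact: cvg_expmx.
  by move/cvg_mxP; exact.
apply: (norm_lim_le co cD); apply: nearW => N.
have serE (V : zmodType) (u : nat -> V) : series u (N + 2)%N - u 0%N - u 1%N =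
    \sum_(2 <= k < N + 2) u k.
  rewrite /series /= (@big_cat_nat _ _ _ 2) ?leq_addl//=.
  have -> : \sum_(0 <= k < 2) u k = u 0%N + u 1%N.
    by rewrite big_nat_recr//= big_nat1.
  by rewrite -addrA -opprD addrAC subrr add0r.
have -> : series (exp_term D) (N + 2)%N - 1%:M - D =
    \sum_(2 <= k < N + 2) exp_term D k.
  by rewrite -serE /exp_term /= expr0 expr1 !fact0 invr1 !scale1r.
have /row_bounded_entry : row_bounded emb (\sum_(2 <= k < N + 2) exp_coeff d k)
    (\sum_(2 <= k < N + 2) exp_term D k).
  by apply: row_bounded_sum => k _; exact: row_bounded_exp_term.
move=> /(_ i j)/le_trans; apply; rewrite (ler_emb co) -serE.
rewrite /exp_coeff /= expr0 expr1 fact0 divr1 (_ : 1`! = 1)%N// divr1.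
rewrite !lerD2r.
apply: (nondecreasing_cvgn_le _ (is_cvg_series_exp_coeff d)) => m p mp.
rewrite -subr_ge0 sub_series_geq// sumr_ge0// => k _; exact: exp_coeff_ge0.
Qed.

Lemma expmx0 : expmx 0 = 1%:M :> 'M[K]_n.
Proof.
apply/matrixP => i j; apply/eqP; rewrite -subr_eq0 -normr_le0.
have := @expmx_remainder 0 0 i j (lexx 0) (@row_bounded0 R K emb n).
by rewrite expR0 subrr !subr0 rmorph0 !mxE.
Qed.

Lemma expmxN A : expmx A *m expmx (- A) = 1%:M.
Proof.
by rewrite -expmxD ?subrr ?expmx0// mulmxN mulNmx.
Qed.

Lemma expmx_unit A : expmx A \in unitmx.
Proof. by have [] := mulmx1_unit (expmxN A). Qed.

Lemma expmx_comm A T : A *m T = T *m A -> expmx A *m T = T *m expmx A.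
Proof.
move=> AT.
have c1 : series (exp_term A) N *m T @[N --> \oo] --> expmx A *m T.
  by apply: cvg_mulmx; [exact: cvg_expmx|exact: cvg_cst].
have c2 : T *m series (exp_term A) N @[N --> \oo] --> T *m expmx A.
  apply: (@cvg_mulmx _ _ _ _ _ _ _ (fun=> T)); first exact: cvg_cst.
  exact: cvg_expmx.
suff E : (fun N => series (exp_term A) N *m T) = (fun N => T *m series (exp_term A) N).
  by rewrite E in c1; rewrite -(cvg_lim _ c1)// -(cvg_lim _ c2).
apply/funext => N; rewrite /series /= mulmx_suml mulmx_sumr.
apply: eq_bigr => k _; rewrite /exp_term -scalemxAl -scalemxAr; congr (_ *: _).
exact/esym/commrX/esym.
Qed.

End MatrixExponential.

(** * Difference quotients *)

(** The filters [0^'], [0^'+] and [0^'-], which define the two-sided and the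
    lateral derivatives, only matter through these two properties. *)
Definition increments (R : realType) (F : set_system R) : Prop :=
  F --> (0 : R) /\ \forall h \near F, h != 0.

Lemma increments_dnbhs (R : realType) : increments ((0 : R)^').
Proof.
by split; [exact: cvg_within|exact: nbhs_dnbhs_neq].
Qed.

Lemma increments_right (R : realType) : increments ((0 : R)^'+).
Proof.
split; first exact: cvg_within.
by near=> h; rewrite gt_eqF//; near: h; exact: nbhs_right_gt.
Unshelve. all: by end_near. Qed.

Lemma increments_left (R : realType) : increments ((0 : R)^'-).
Proof.
split; first exact: cvg_within.
by near=> h; rewrite lt_eqF//; near: h; exact: nbhs_left_lt.
Unshelve. all: by end_near. Qed.

Lemma cvg_shift_dnbhs (R : realType) (T : topologicalType) (x : R -> T) t (l : T) :
  x (t + h) @[h --> (0 : R)^'] --> l -> x @ t^' --> l.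
Proof.
move=> xl; have unshift : s - t @[s --> t^'] --> (0 : R)^'.
  move=> P P0; have {}P0 : \forall h \near (0 : R), h != 0 -> P h by exact: P0.
  have st : s - t @[s --> t] --> (0 : R).
    rewrite -(subrr t); apply: (cvgB (f := id) (g := fun=> t)).
      exact: cvg_id.
    exact: cvg_cst.
  have {}P0 : \forall s \near t, s - t != 0 -> P (s - t) by exact: st _ P0.
  suff : \forall s \near t, s != t -> P (s - t) by [].
  by apply: filterS P0 => s; rewrite subr_eq0.
have := cvg_comp (fun s => s - t) _ unshift xl.
by under eq_cvg do rewrite /= addrC subrK.
Qed.

Section DifferenceQuotients.
Variables (R : realType) (K : numFieldType) (emb : {rmorphism R -> K}).
Variable co : real_coordinates emb.
Variable F : set_system R.
Context {FF : ProperFilter F}.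
Hypothesis F0 : increments F.

Definition dq_lim m n (x : R -> 'M[K]_(m, n)) (a : 'M[K]_(m, n)) t (d : 'M[K]_(m, n)) :=
  diff_quot emb x a t h @[h --> F] --> d.

Lemma cvg_emb_increments : emb h @[h --> F] --> 0.
Proof. by rewrite -(rmorph0 emb); apply: (cvg_emb co); case: F0. Qed.

Lemma dq_limE m n (x : R -> 'M[K]_(m, n)) a t :
  \forall h \near F, x (t + h) = a + emb h *: diff_quot emb x a t h.
Proof.
have [_] := F0; apply: filterS => h h0.
by rewrite /diff_quot scalerA divff ?fmorph_eq0// scale1r addrCA subrr addr0.
Qed.

Lemma dq_lim_cvg m n (x : R -> 'M[K]_(m, n)) a t d :
  dq_lim x a t d -> x (t + h) @[h --> F] --> a.
Proof.
move=> xd; rewrite -[a in _ --> a]addr0 -(scale0r d).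
apply: (cvg_eq_near (f := fun h => a + emb h *: diff_quot emb x a t h)).
  by apply: filterS (dq_limE x a t) => h ->.
apply: cvgD; first exact: cvg_cst.
by apply: cvgZ => //; exact: cvg_emb_increments.
Qed.

Lemma dq_lim_cst m n (a : 'M[K]_(m, n)) t : dq_lim (fun=> a) a t 0.
Proof.
rewrite /dq_lim /diff_quot subrr.
by under eq_cvg do rewrite scaler0; exact: cvg_cst.
Qed.

Lemma dq_limD m n (x y : R -> 'M[K]_(m, n)) a b t dx dy :
  dq_lim x a t dx -> dq_lim y b t dy ->
  dq_lim (fun s => x s + y s) (a + b) t (dx + dy).
Proof.
move=> xd yd; apply: (cvg_eq_near _ (cvgD xd yd)).
by apply: nearW => h; rewrite fctE /diff_quot -scalerDr opprD addrACA.
Qed.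

Lemma dq_limM m n q (x : R -> 'M[K]_(m, n)) (y : R -> 'M[K]_(n, q)) a b t dx dy :
  dq_lim x a t dx -> dq_lim y b t dy ->
  dq_lim (fun s => x s *m y s) (a *m b) t (dx *m b + a *m dy).
Proof.
move=> xd yd; have yb := dq_lim_cvg yd.
have aC : (fun=> a) @ F --> a by exact: cvg_cst.
apply: (cvg_eq_near _ (cvgD (cvg_mulmx xd yb) (cvg_mulmx aC yd))).
apply: nearW => h; rewrite fctE /diff_quot -scalemxAl -scalemxAr. rewrite -scalerDr.
by rewrite mulmxBl mulmxBr addrA subrK.
Qed.

Lemma dq_lim_invmx n (x : R -> 'M[K]_n) a t d :
  (forall s, x s \in unitmx) -> a \in unitmx ->
  dq_lim x a t d ->
  dq_lim (fun s => invmx (x s)) (invmx a) t (- (invmx a *m d *m invmx a)).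
Proof.
move=> xu au xd; have xa := dq_lim_cvg xd.
have xV : invmx (x (t + h)) @[h --> F] --> invmx a.
  by apply: cvg_invmx => // h; exact: xu.
have aC : (fun=> invmx a) @ F --> invmx a by exact: cvg_cst.
apply: (cvg_eq_near _ (cvgN (cvg_mulmx (cvg_mulmx xV xd) aC))).
apply: nearW => h.
rewrite fctE /diff_quot -scalemxAr -scalemxAl -scalerN; congr (_ *: _).
by rewrite mulmxBr mulVmx ?xu// mulmxBl mul1mx -mulmxA mulmxV// mulmx1 opprB.
Qed.

Lemma dq_lim_scale n (P : 'M[K]_n) t :
  dq_lim (fun s => emb s *: P) (emb t *: P) t P.
Proof.
apply: (cvg_eq_near (f := fun=> P)); last exact: cvg_cst.
have [_] := F0; apply: filterS => h h0.
rewrite /diff_quot rmorphD scalerDl addrAC subrr add0r scalerA mulVf ?scale1r//.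
by rewrite fmorph_eq0.
Qed.

Lemma row_bounded_near (T : Type) (G : set_system T) {GG : Filter G} n
    (f : T -> 'M[K]_n) (M : 'M[K]_n) : f @ G --> M ->
  exists2 c, 0 <= c & \forall t \near G, row_bounded emb c (f t).
Proof.
move=> fM; have [c c0 Mc] := row_bounded_ex co M.
exists (c + n%:R); first by rewrite addr_ge0.
have near1 : \forall t \near G, forall i j, `|M i j - f t i j| < 1.
  apply: filter_forall => i; apply: filter_forall => j.
  by move/cvg_mxP : fM => /(_ i j)/cvgr_dist_lt; apply.
apply: filterS near1 => t ft.
have -> : f t = M + (f t - M) by rewrite addrC subrK.
apply: row_boundedD => // i; rewrite rmorph_nat.
rewrite (@le_trans _ _ (\sum_(j < n) 1))//.
  apply: ler_sum => j _; rewrite !mxE -normrN opprB; exact: ltW.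
by rewrite sumr_const card_ord.
Qed.

End DifferenceQuotients.

(** [expR (- x) >= 1 - x] gives [expR x <= 1 / (1 - x)], which is at most
    [1 + x + 2 x ^ 2] for [x <= 1 / 2]. *)
Lemma expR_remainder (R : realType) (x : R) : 0 <= x <= 2^-1 ->
  expR x - 1 - x <= 2 * x ^+ 2.
Proof.
move=> /andP[x0 x2].
have x1 : 0 < 1 - x by rewrite subr_gt0 (le_lt_trans x2)// invf_lt1// ltr1n.
have e1 : expR x * (1 - x) <= 1.
  rewrite -[leRHS](expRxMexpNx_1 x) ler_wpM2l ?expR_ge0//.
  by have := expR_ge1Dx (- x).
rewrite -(ler_pM2r x1); nra.
Qed.

Section ExponentialDerivative.
Variables (R : realType) (K : numFieldType) (emb : {rmorphism R -> K}).
Variable co : real_coordinates emb.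
Variable F : set_system R.
Context {FF : ProperFilter F}.
Hypothesis F0 : increments F.

(** Commutation allows the exponential of the base value to be factored out, which
    leaves the first-order expansion at [0]. *)
Lemma dq_lim_expmx n (L : R -> 'M[K]_n) a t d :
  (\forall h \near F, L (t + h) *m a = a *m L (t + h)) ->
  dq_lim emb F L a t d ->
  dq_lim emb F (fun s => expmx (L s)) (expmx a) t (expmx a *m d).
Proof.
move=> La Ld; pose D h : 'M[K]_n := L (t + h) - a.
have expLE : \forall h \near F, expmx (L (t + h)) = expmx a *m expmx (D h).
  apply: filterS La => h La.
  rewrite -(expmxD co) ?[a + _]addrC ?subrK//.
  by rewrite /D mulmxBr mulmxBl La.
pose rem h : 'M[K]_n := (emb h)^-1 *: (expmx (D h) - 1%:M - D h).
suff rem0 : rem @ F --> (0 : 'M[K]_n).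
  have aC : (fun=> expmx a) @ F --> expmx a by exact: cvg_cst.
  rewrite -[d]add0r; apply: (cvg_eq_near _ (cvg_mulmx aC (cvgD rem0 Ld))).
  apply: filterS expLE => h hE.
  rewrite fctE /diff_quot /rem -/(D h) -scalerDr subrK hE -scalemxAr mulmxBr.
  by rewrite mulmx1.
have [c c0 Dc] := row_bounded_near co Ld.
apply/cvg_mxP => i j; rewrite mxE.
apply: (@cvg_dominated _ _ _ co _ _ _ _ _ (fun h => 2 * c ^+ 2 * `|h|)); last first.
  rewrite -(mulr0 (2 * c ^+ 2)); apply: cvgM; first exact: cvg_cst.
  by rewrite -(normr0 R); apply: cvg_norm; case: F0.
have small : \forall h \near F, c * `|h| <= 2^-1.
  have : c * `|h| @[h --> F] --> 0.
    rewrite -(mulr0 c); apply: cvgM; first exact: cvg_cst.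
    by rewrite -(normr0 R); apply: cvg_norm; case: F0.
  by move=> /cvgr_le; apply; rewrite invr_gt0.
near=> h; have h0 : h != 0 by near: h; case: F0.
have hc : 0 <= c * `|h| <= 2^-1 by rewrite mulr_ge0//; near: h.
have Dhc : row_bounded emb (c * `|h|) (D h).
  have -> : D h = emb h *: diff_quot emb L a t h.
    by rewrite /diff_quot scalerA divff ?fmorph_eq0// scale1r.
  move=> k; rewrite mulrC rmorphM -(norm_emb co).
  under eq_bigr do rewrite mxE normrM.
  rewrite -mulr_sumr ler_wpM2l//; move: k.
  by near: h.
rewrite subr0 mxE normrM -fmorphV (norm_emb co) normfV.
have h0' : 0 < `|h|^-1 by rewrite invr_gt0 normr_gt0.
have := expmx_remainder co i j (andP hc).1 Dhc.
move=> /(ler_wpM2l (emb_ge0 co (ltW h0')))/le_trans; apply.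
rewrite -rmorphM (ler_emb co) mulrC ler_pdivrMr ?normr_gt0//.
by rewrite (le_trans (expR_remainder hc))// exprMn mulrA [`|h| ^+ 2]expr2 mulrA.
Unshelve. all: by end_near. Qed.

End ExponentialDerivative.

(** * Constancy and antiderivatives *)

Lemma is_deriveP (R : realType) (f : R -> R) t d :
  is_derive t (1 : R) f d <-> h^-1 * (f (t + h) - f t) @[h --> (0 : R)^'] --> d.
Proof.
have E : (fun h : R => h^-1 *: ((f \o shift t) (h *: (1 : R)) - f t)) =
    (fun h => h^-1 * (f (t + h) - f t)).
  by apply/funext => h; rewrite /= [t + h]addrC [h%:A]mulr1.
rewrite -E; split=> [[df <-]|fd]; first exact: df.
by apply: DeriveDef; [apply: cvgP fd|exact: cvg_lim fd].
Qed.

Lemma continuous_antiderivative (R : realType) (f : R -> R) (a b : R) :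
  continuous f -> exists F : R -> R, forall t, a < t < b -> is_derive t (1 : R) F (f t).
Proof.
move=> fc; exists (fun x => \int[lebesgue_measure]_(t in `[a, x]) f t) => t.
move=> /andP[at_ tb].
have fi : lebesgue_measure.-integrable `[a, b] (EFin \o f).
  apply: continuous_compact_integrable; first exact: segment_compact.
  exact: continuous_subspaceT.
have [dF FE] := continuous_FTC1_closed tb fi at_ (fc t).
by apply: DeriveDef; [exact: dF|rewrite -derive1E; exact: FE].
Qed.

Lemma is_derive0_const (R : realType) (f : R -> R) (a b : R) :
  (forall t, a < t < b -> is_derive t (1 : R) f 0) ->
  forall s t, a < s < b -> a < t < b -> f s = f t.
Proof.
move=> f0; suff le_const s t : a < s < b -> a < t < b -> s <= t -> f s = f t.
  move=> s t sab tab; have [st|/ltW ts] := leP s t; first exact: le_const.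
  by apply/esym/le_const.
move=> /andP[as_ sb] /andP[at_ tb] st; apply/esym/eqP; rewrite -subr_eq0; apply/eqP.
have [|||c _ ->] := @MVT_segment R f (fun=> 0) s t; last by rewrite mul0r.
- exact: st.
- move=> x; rewrite in_itv /= => /andP[sx xt]; apply: f0.
  by rewrite (lt_trans as_ sx) (lt_trans xt tb).
apply: continuous_in_subspaceT => x; rewrite inE /= in_itv /= => /andP[sx xt].
apply/differentiable_continuous/derivable1_diffP.
have [|//] := f0 x; by rewrite (lt_le_trans as_ sx) (le_lt_trans xt tb).
Qed.

Section Coordinates.
Variables (R : realType) (K : numFieldType) (emb : {rmorphism R -> K}).
Variable co : real_coordinates emb.

Lemma has_deriv_entry m n (x : R -> 'M[K]_(m, n)) t (d : 'M[K]_(m, n)) :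
  has_deriv emb x t d <->
  forall i j, (emb h)^-1 * (x (t + h) i j - x t i j) @[h --> (0 : R)^'] --> d i j.
Proof.
split=> [/cvg_mxP xd i j|xd].
  by apply: (cvg_eq_near _ (xd i j)); apply: nearW => h; rewrite /diff_quot !mxE.
apply/cvg_mxP => i j; apply: (cvg_eq_near _ (xd i j)).
by apply: nearW => h; rewrite /diff_quot !mxE.
Qed.

Lemma has_deriv_cre m n (x : R -> 'M[K]_(m, n)) t (d : 'M[K]_(m, n)) i j :
  has_deriv emb x t d ->
  is_derive t (1 : R) (fun s => cre co (x s i j)) (cre co (d i j)).
Proof.
move=> /has_deriv_entry/(_ i j)/(cvg_cre (co := co)) xd; apply/is_deriveP.
apply: (cvg_eq_near _ xd); apply: nearW => h.
by rewrite -fmorphV creM creB.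
Qed.

Lemma has_deriv_cim m n (x : R -> 'M[K]_(m, n)) t (d : 'M[K]_(m, n)) i j :
  has_deriv emb x t d ->
  is_derive t (1 : R) (fun s => cim co (x s i j)) (cim co (d i j)).
Proof.
move=> /has_deriv_entry/(_ i j)/(cvg_cim (co := co)) xd; apply/is_deriveP.
apply: (cvg_eq_near _ xd); apply: nearW => h.
by rewrite -fmorphV cimM cimB.
Qed.

Lemma has_deriv0_const m n (u : R -> 'M[K]_(m, n)) (a b : R) :
  (forall t, a < t < b -> has_deriv emb u t 0) ->
  forall s t, a < s < b -> a < t < b -> u s = u t.
Proof.
move=> u0 s t sab tab; apply/matrixP => i j.
rewrite (coordE co (u s i j)) (coordE co (u t i j)).
have re0 : cre co 0 = 0 by rewrite -(subrr 0) creB subrr.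
have im0 : cim co 0 = 0 by rewrite -(subrr 0) cimB subrr.
congr (emb _ + _ * emb _).
  apply: (@is_derive0_const R (fun s => cre co (u s i j)) a b) => // r rab.
  by have := has_deriv_cre i j (u0 r rab); rewrite mxE re0.
apply: (@is_derive0_const R (fun s => cim co (u s i j)) a b) => // r rab.
by have := has_deriv_cim i j (u0 r rab); rewrite mxE im0.
Qed.

Lemma has_deriv_antiderivative m n (f : R -> 'M[K]_(m, n)) (a b : R) :
  continuous f ->
  exists F : R -> 'M[K]_(m, n), forall t, a < t < b -> has_deriv emb F t (f t).
Proof.
move=> fc.
have cent i j t : f s i j @[s --> t] --> f t i j.
  by have /cvg_mxP := fc t; exact.
have [Fr Frd] : exists Fr : 'I_m -> 'I_n -> R -> R, forall i j t, a < t < b ->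
    is_derive t (1 : R) (Fr i j) (cre co (f t i j)).
  have fij i j : continuous (fun s => cre co (f s i j)).
    by move=> t; exact: (cvg_cre (co := co) (cent i j t)).
  have H i j := @continuous_antiderivative R _ a b (fij i j).
  by exists (fun i j => projT1 (cid (H i j))) => i j; exact: (projT2 (cid (H i j))).
have [Fi Fid] : exists Fi : 'I_m -> 'I_n -> R -> R, forall i j t, a < t < b ->
    is_derive t (1 : R) (Fi i j) (cim co (f t i j)).
  have fij i j : continuous (fun s => cim co (f s i j)).
    by move=> t; exact: (cvg_cim (co := co) (cent i j t)).
  have H i j := @continuous_antiderivative R _ a b (fij i j).
  by exists (fun i j => projT1 (cid (H i j))) => i j; exact: (projT2 (cid (H i j))).
exists (fun t => \matrix_(i, j) (emb (Fr i j t) + cunit co * emb (Fi i j t))).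
move=> t tab; apply/has_deriv_entry => i j.
have /is_deriveP/(cvg_emb co) dr := Frd i j t tab.
have /is_deriveP/(cvg_emb co) di := Fid i j t tab.
rewrite (coordE co (f t i j)).
have jC : (fun=> cunit co) @ (0 : R)^' --> cunit co by exact: cvg_cst.
apply: (cvg_eq_near _ (cvgD dr (cvgM jC di))); apply: nearW => h.
rewrite !mxE fctE /= !rmorphM !rmorphB !fmorphV.
by ring.
Qed.

End Coordinates.

(** * Logarithms of matrices *)

Section LogAlongPath.
Variables (R : realType) (K : numFieldType) (emb : {rmorphism R -> K}).
Variables (co : real_coordinates emb) (n : nat).

Lemma has_deriv_embZ m q (f : R -> R) t (d : R) (N : 'M[K]_(m, q)) :
  is_derive t (1 : R) f d -> has_deriv emb (fun s => emb (f s) *: N) t (emb d *: N).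
Proof.
move=> /is_deriveP/(cvg_emb co) fd; apply/has_deriv_entry => i j.
have NC : (fun=> N i j) @ (0 : R)^' --> N i j by exact: cvg_cst.
rewrite !mxE; apply: (cvg_eq_near _ (cvgM fd NC)); apply: nearW => h.
by rewrite !mxE /= rmorphM rmorphB fmorphV; ring.
Qed.

Lemma has_deriv_cvg m q (x : R -> 'M[K]_(m, q)) t d :
  has_deriv emb x t d -> x @ t --> x t.
Proof.
move=> xd; apply/continuous_withinNx/cvg_shift_dnbhs.
exact: (dq_lim_cvg co (increments_dnbhs R) xd).
Qed.

Variables (N : 'M[K]_n) (z dz : R -> K).

(** The logarithm of [1 + z N] is continued along the path [z] by integrating
    [(1 + z N)^-1 N dz]; all these matrices are rational functions of [N], hence
    the integral commutes with whatever commutes with [N], itself included. *)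
Lemma log_along_path :
  (forall t, has_deriv emb (fun s => 1%:M + z s *: N) t (dz t *: N)) ->
  continuous dz ->
  (forall t, 1%:M + z t *: N \in unitmx) -> z 0 = 0 ->
  exists2 L : 'M[K]_n, expmx L = 1%:M + z 1 *: N &
    forall T, T *m N = N *m T -> T *m L = L *m T.
Proof.
move=> pd dzc pu z0; pose p t := 1%:M + z t *: N.
pose l t : 'M[K]_n := invmx (p t) *m (dz t *: N).
have pc : continuous p by move=> t; exact: has_deriv_cvg (pd t).
have lc : continuous l.
  move=> t; apply: cvg_mulmx.
    by apply: cvg_invmx; [exact: pu|exact: pu|exact: pc].
  by apply: cvgZ; [exact: dzc|exact: cvg_cst].
(* Any open interval containing the ends [0] and [1] of the path would do. *)
have [F Fd] := has_deriv_antiderivative co (- 1) 2 lc.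
pose L t := F t - F 0.
have Ld t : -1 < t < 2 -> has_deriv emb L t (l t).
  move=> tab; rewrite -[l t]addr0.
  apply: (dq_limD (Fd t tab)); exact: dq_lim_cst.
have in0 : - 1 < (0 : R) < 2 by apply/andP; split; lra.
have in1 : - 1 < (1 : R) < 2 by apply/andP; split; lra.
have pcomm T t : T *m N = N *m T -> T *m p t = p t *m T.
  by move=> TN; rewrite mulmxDr mulmxDl mulmx1 mul1mx -scalemxAr -scalemxAl TN.
have lcomm T t : T *m N = N *m T -> T *m l t = l t *m T.
  move=> TN; rewrite /l -!scalemxAr -scalemxAl -mulmxA -TN !mulmxA; congr (_ *: (_ *m N)).
  rewrite -[LHS](mulKmx (pu t)) -/(p t) [p t *m _]mulmxA -pcomm//.
  by rewrite -[T *m p t *m _]mulmxA mulmxV ?mulmx1//; exact: pu.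
have Lcomm T t : -1 < t < 2 -> T *m N = N *m T -> T *m L t = L t *m T.
  move=> tab TN; pose u s := T *m L s + L s *m - T.
  have u0 s : -1 < s < 2 -> has_deriv emb u s 0.
    move=> sab.
    have TC : dq_lim emb (0 : R)^' (fun=> T) T s 0 by exact: dq_lim_cst.
    have NTC : dq_lim emb (0 : R)^' (fun=> - T) (- T) s 0 by exact: dq_lim_cst.
    have -> : 0 = (0 *m L s + T *m l s) + (l s *m - T + L s *m 0).
      by rewrite mul0mx mulmx0 add0r addr0 mulmxN lcomm// subrr.
    exact: (dq_limD (dq_limM co (increments_dnbhs R) TC (Ld s sab))
                    (dq_limM co (increments_dnbhs R) (Ld s sab) NTC)).
  have := has_deriv0_const co u0 tab in0.
  rewrite /u mulmxN /L [F 0 - _]subrr mulmx0 mul0mx addr0 -/(L t).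
  by move/eqP; rewrite subr_eq0 => /eqP.
have LL s t : -1 < s < 2 -> -1 < t < 2 -> L s *m L t = L t *m L s.
  by move=> sab tab; apply: (Lcomm _ _ tab); exact/esym/(Lcomm _ _ sab).
pose G t := expmx (- L t) *m p t.
have G0 t : -1 < t < 2 -> has_deriv emb G t 0.
  move=> tab.
  have NLd : has_deriv emb (fun s => - L s) t (- l t).
    apply: (cvg_eq_near _ (cvgN (Ld t tab))); apply: nearW => h.
    by rewrite fctE /diff_quot -scalerN opprB opprK addrC.
  have NLcomm : \forall h \near (0 : R)^', - L (t + h) *m - L t = - L t *m - L (t + h).
    have th : t + h @[h --> (0 : R)^'] --> t.
      rewrite -{2}(addr0 t); apply: cvgD; first exact: cvg_cst.
      exact: (increments_dnbhs R).1.
    have tab' : t \in `]-1, 2[ by rewrite in_itv.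
    have near_tab : \forall h \near (0 : R)^', t + h \in `]-1, 2[.
      exact: th _ (near_in_itvoo tab').
    apply: filterS near_tab => h.
    by rewrite in_itv /= => hab; rewrite !mulmxN !mulNmx LL.
  have eLd : dq_lim emb (0 : R)^' (fun s => expmx (- L s)) (expmx (- L t)) t
      (expmx (- L t) *m - l t).
    exact: (dq_lim_expmx co (increments_dnbhs R) NLcomm NLd).
  have -> : 0 = expmx (- L t) *m - l t *m p t + expmx (- L t) *m (dz t *: N).
    have lp : l t *m p t = dz t *: N.
      by rewrite pcomm ?(mulKVmx (pu t))//; exact/esym/lcomm.
    by rewrite -mulmxA -mulmxDr mulNmx lp addNr mulmx0.
  exact: (dq_limM co (increments_dnbhs R) eLd (pd t)).
have := has_deriv0_const co G0 in1 in0.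
rewrite /G {2}/L subrr oppr0 (expmx0 co) mul1mx {2}/p z0 scale0r addr0 => G1.
exists (L 1); last by move=> T; exact: Lcomm.
by rewrite -[1%:M + _]/(p 1) -[p 1]mul1mx -(expmxN co (L 1)) -mulmxA G1 mulmx1.
Qed.

End LogAlongPath.

Section ComplexLogarithm.
Variable R : realType.
Local Notation C := (R[i]).

Lemma notin_seq (s : seq R) : exists c, c \notin s.
Proof.
exists (\sum_(b <- s) `|b| + 1); apply/negP => cs.
have : \sum_(b <- s) `|b| + 1 <= \sum_(b <- s) `|b|.
  rewrite [leRHS](big_rem _ cs)/= (le_trans (ler_norm _))// lerDl.
  exact: sumr_ge0.
by rewrite gerDl ler10.
Qed.

(** A parabolic arc from [0] to [1] is determined by any other of its points:
    each root excludes at most one of these arcs. *)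
Lemma arc_avoiding_roots (q : {poly C}) : q.[0] != 0 -> q.[1] != 0 ->
  exists c : R, forall t : R, q.[(t +i* (c * (t * (1 - t))))%C] != 0.
Proof.
move=> q0 q1; have [rs qE] := closed_field_poly_normal q.
have [c cP] := notin_seq
  [seq complex.Im r / (complex.Re r * (1 - complex.Re r)) | r <- rs].
exists c => t; apply/negP => qt.
have rt : (t +i* (c * (t * (1 - t))))%C \in rs.
  move: qt; rewrite qE hornerZ mulf_eq0 lead_coef_eq0 => /orP[/eqP q_0|].
    by rewrite q_0 horner0 eqxx in q0.
  by rewrite -root_prod_XsubC.
have [t0|t0] := eqVneq t 0.
  by move: qt; rewrite t0 mul0r mulr0 (negbTE q0).
have [t1|t1] := eqVneq t 1.
  by move: qt; rewrite t1 subrr !mulr0 (negbTE q1).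
case/negP: cP; apply/mapP; exists (t +i* (c * (t * (1 - t))))%C => //=.
by rewrite mulfK// mulf_neq0// subr_eq0 eq_sym.
Qed.

(** [det (1 + z N)], for [N := M - 1], is a polynomial in [z] which does not vanish
    at [0] and [1]; the logarithm is continued from [1] to [M] along an arc which
    avoids its roots.  The commutation property serves to compare [L] with its
    conjugate when [M] is real. *)
Lemma complex_logarithm n (M : 'M[C]_n) : M \in unitmx ->
  exists2 L : 'M[C]_n, expmx L = M & forall T, T *m M = M *m T -> T *m L = L *m T.
Proof.
move=> Mu; pose co := complex_coordinates R; pose N := M - 1%:M.
pose q := \det (1%:M + 'X *: map_mx polyC N).
have qE z : q.[z] = \det (1%:M + z *: N).
  rewrite -horner_evalE -det_map_mx; congr (\det _).
  apply/matrixP => i j; rewrite !mxE rmorphD rmorphM rmorph_nat.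
  by rewrite /= /horner_eval hornerX hornerC.
have q0 : q.[0] != 0 by rewrite qE scale0r addr0 det1 oner_eq0.
have q1 : q.[1] != 0.
  by rewrite qE scale1r /N addrC subrK -unitfE -unitmxE.
have [c qc] := arc_avoiding_roots q0 q1.
pose z t : C := (t +i* (c * (t * (1 - t))))%C.
pose dz t : C := (1 +i* (c * (1 - 2 * t)))%C.
have zE t : 1%:M + z t *: N =
    1%:M + (real_complex R t *: N + real_complex R (c * (t * (1 - t))) *: ('i%C *: N)).
  by rewrite scalerA -scalerDl; congr (_ + _ *: _); rewrite mulrC; exact: complexE.
have dzE t : dz t *: N =
    0 + (real_complex R 1 *: N + real_complex R (c * (1 - 2 * t)) *: ('i%C *: N)).
  by rewrite add0r scalerA -scalerDl; congr (_ *: _); rewrite mulrC; exact: complexE.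
have gd t : is_derive t (1 : R) (fun s => c * (s * (1 - s))) (c * (1 - 2 * t)).
  apply/is_deriveP; apply: (cvg_eq_near (f := fun h => c * (1 - 2 * t) - c * h)).
    have [_] := increments_dnbhs R; apply: filterS => h h0.
    by field.
  have lim0 : c * (1 - 2 * t) - c * h @[h --> (0 : R)^'] --> c * (1 - 2 * t) - c * 0.
    apply: cvgB; first exact: cvg_cst.
    by apply: cvgM; [exact: cvg_cst|exact: (increments_dnbhs R).1].
  by rewrite mulr0 subr0 in lim0.
have idd t : is_derive t (1 : R) id 1 by exact: is_derive_id.
have zd t : has_deriv (real_complex R) (fun s => 1%:M + z s *: N) t (dz t *: N).
  rewrite dzE (funext zE).
  apply: dq_limD; first exact: dq_lim_cst.
  exact: (dq_limD (has_deriv_embZ co (idd t)) (has_deriv_embZ co (gd t))).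
have dzc : continuous (dz : R -> (C : numFieldType)).
  move=> t; rewrite /continuous_at.
  have -> : dz t = real_complex R 1 + 'i%C * real_complex R (c * (1 - 2 * t)).
    exact: complexE.
  apply: (@cvg_coord _ _ _ co _ (nbhs t)); first exact: cvg_cst.
  apply: cvgM; first exact: cvg_cst.
  apply: cvgB; first exact: cvg_cst.
  by apply: cvgM; [exact: cvg_cst|exact: cvg_id].
have zu t : 1%:M + z t *: N \in unitmx by rewrite unitmxE unitfE -qE qc.
have z0 : z 0 = 0 by rewrite /z mul0r mulr0.
have [L LE Lcomm] := log_along_path co zd dzc zu z0.
exists L; first by rewrite LE /z subrr !mulr0 scale1r /N addrC subrK.
move=> T TM; apply: Lcomm.
by rewrite /N mulmxBl mulmxBr TM mulmx1 mul1mx.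
Qed.

End ComplexLogarithm.

(** The partial sums of the exponential have rational coefficients.  The morphisms
    meant are the inclusion of [R] into [R[i]] and complex conjugation. *)
Lemma map_expmx (R : realType) (K K' : numFieldType) (emb : {rmorphism R -> K})
    (emb' : {rmorphism R -> K'}) (co : real_coordinates emb)
    (co' : real_coordinates emb') (f : {rmorphism K -> K'}) n (M : 'M[K]_n) :
  (forall (u : nat -> K) l, u @ \oo --> l -> f (u k) @[k --> \oo] --> f l) ->
  map_mx f (expmx M) = expmx (map_mx f M).
Proof.
move=> fc.
have fS : map_mx f (series (exp_term M) N) @[N --> \oo] --> map_mx f (expmx M).
  apply/cvg_mxP => i j; rewrite mxE; under eq_cvg do rewrite mxE.
  by apply: fc; have /cvg_mxP := @cvg_expmx _ _ _ co _ M; exact.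
rewrite -(cvg_lim _ fS)//; apply: cvg_lim => //.
apply: (cvg_eq_near _ (@cvg_expmx _ _ _ co' _ (map_mx f M))); apply: nearW => N.
rewrite /series /= raddf_sum; apply: eq_bigr => k _.
rewrite /exp_term /= map_mxZ fmorphV rmorph_nat; congr (_ *: _).
elim: k => [|k IH]; first by rewrite !expr0 map_mx1.
by rewrite !exprS IH; exact/esym/map_mxM.
Qed.

Section RealLogarithm.
Variable R : realType.
Local Notation C := (R[i]).

Lemma cmx_expmx n (M : 'M[R]_n) : cmx (expmx M) = expmx (cmx M).
Proof.
apply: (map_expmx (self_coordinates R) (complex_coordinates R)) => u l.
exact: (cvg_emb (complex_coordinates R)).
Qed.

Lemma conj_expmx n (M : 'M[C]_n) : map_mx conjc (expmx M) = expmx (map_mx conjc M).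
Proof.
apply: (map_expmx (complex_coordinates R) (complex_coordinates R)) => u l ul.
have ulr : complex.Re (u k) @[k --> \oo] --> complex.Re l.
  exact: (cvg_cre (co := complex_coordinates R) ul).
have uli : - complex.Im (u k) @[k --> \oo] --> - complex.Im l.
  by apply: cvgN; exact: (cvg_cim (co := complex_coordinates R) ul).
rewrite /= (_ : conjc l =
    real_complex R (complex.Re l) + 'i%C * real_complex R (- complex.Im l)).
  apply: (cvg_coord (co := complex_coordinates R)).
    by apply: (cvg_eq_near _ ulr); apply: nearW => k; case: (u k).
  by apply: (cvg_eq_near _ uli); apply: nearW => k; case: (u k).
by rewrite [LHS]complexE; case: (l).
Qed.

(** [M ^ 2] is the exponential of [L + conj L], where [L] is a complex logarithm of
    [M]; the conjugate of [L] is another one, which commutes with [M], hence with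
    [L]. *)
Lemma real_logarithm_sqr n (M : 'M[R]_n) : M \in unitmx ->
  exists L : 'M[R]_n, expmx L = M *m M.
Proof.
move=> Mu; have cMu : cmx M \in unitmx by rewrite map_unitmx.
have [L LM Lcomm] := complex_logarithm cMu.
have conjM : map_mx conjc (cmx M) = cmx M.
  by apply/matrixP => i j; rewrite !mxE conjc_real.
have LMc : L *m cmx M = cmx M *m L by apply/esym/Lcomm.
have Lconj : map_mx conjc L *m L = L *m map_mx conjc L.
  by apply: Lcomm; rewrite -conjM -!map_mxM LMc.
exists (\matrix_(i, j) (complex.Re (L i j) *+ 2)).
apply: (map_mx_inj (f := real_complex R)); rewrite -!/(cmx _) cmx_expmx.
rewrite [RHS](map_mxM (real_complex R)) -/(cmx M).
rewrite -{2}conjM -LM conj_expmx -(expmxD (complex_coordinates R)); last exact/esym.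
congr expmx; apply/matrixP => i j; rewrite !mxE.
by case: (L i j) => a b; apply/eqP; rewrite eq_complex /= subrr mulr2n !eqxx.
Qed.

End RealLogarithm.

(** * The grid *)

Section Grid.
Variables (R : realType) (tk zeta : int -> R) (gamma : R -> R).
Hypothesis grid : deviation_grid tk zeta gamma.

Lemma grid_ltS k : tk k < tk (k + 1).
Proof. by case: grid. Qed.

Lemma grid_le_addn k (m : nat) : tk k <= tk (k + m%:Z).
Proof.
elim: m => [|m IH]; first by rewrite addr0.
by rewrite (le_trans IH)// -addn1 PoszD addrA ltW// grid_ltS.
Qed.

Lemma grid_le j k : j <= k -> tk j <= tk k.
Proof.
rewrite -subr_ge0 => jk; have -> : k = j + `|k - j|%N%:Z.
  by rewrite gez0_abs// addrCA subrr addr0.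
exact: grid_le_addn.
Qed.

Lemma grid_locate t : exists k, tk k <= t < tk (k + 1).
Proof.
have [_ toy toNy _ _] := grid.
have [N _ tN] : \forall k \near \oo, tk (- k%:Z) <= t by exact: cvgrNy_le.
have [M _ tM] : \forall k \near \oo, t < tk k%:Z by exact: cvgry_gt.
(* The intervals are counted from a grid point to the left of [t]. *)
pose above m := t < tk (- N%:Z + m%:Z).
have ex_above : exists m, above m.
  exists (N + M)%N; rewrite /above PoszD addrA addNr add0r; exact: tM (leqnn M).
have [m tm min_m] := ex_minnP ex_above.
case: m tm min_m => [|m] tm min_m.
  by move: tm; rewrite /above addr0 ltNge (tN N (leqnn N)).
exists (- N%:Z + m%:Z).
have -> : - N%:Z + m%:Z + 1 = - N%:Z + m.+1%:Z by rewrite -addrA -PoszD addn1.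
rewrite [_ < _]tm andbT leNgt.
by apply/negP => /min_m; rewrite ltnn.
Qed.

Lemma off_grid_between k t : tk k < t < tk (k + 1) -> off_grid tk t.
Proof.
move=> /andP[kt tk1] j tj; rewrite tj in kt tk1.
have [jk|kj] := leP j k; first by move: kt; rewrite ltNge grid_le.
by move: tk1; rewrite ltNge grid_le// addrC lez1D.
Qed.

Lemma gammaE k t : tk k <= t < tk (k + 1) -> gamma t = zeta k.
Proof. by have [_ _ _ _] := grid; exact. Qed.

Lemma off_grid_locate t : off_grid tk t -> exists k, tk k < t < tk (k + 1).
Proof.
move=> ot; have [k /andP[kt tk1]] := grid_locate t; exists k.
by rewrite tk1 andbT lt_neqAle kt andbT eq_sym; apply/eqP/ot.
Qed.

Lemma near_between k t : tk k < t < tk (k + 1) ->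
  \forall s \near t, tk k < s < tk (k + 1).
Proof.
move=> kt; have t_in : t \in `]tk k, tk (k + 1)[ by rewrite in_itv.
by apply: filterS (near_in_itvoo t_in) => s; rewrite in_itv.
Qed.

Lemma near_right_between k : \forall s \near (tk k)^'+, tk k < s < tk (k + 1).
Proof.
near=> s; apply/andP; split; near: s; first exact: nbhs_right_gt.
exact/nbhs_right_lt/grid_ltS.
Unshelve. all: by end_near. Qed.

Lemma near_left_between k : \forall s \near (tk (k + 1))^'-, tk k < s < tk (k + 1).
Proof.
near=> s; apply/andP; split; near: s; last exact: nbhs_left_lt.
exact/nbhs_left_gt/grid_ltS.
Unshelve. all: by end_near. Qed.

End Grid.

(** * Piecewise continuous functions *)

Section PiecewiseContinuous.
Variables (R : realType) (K : numFieldType) (tk : int -> R).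

Lemma PC_continuous m n (x : R -> 'M[K]_(m, n)) : continuous x -> PC tk x.
Proof.
move=> xc; split=> [t _|k]; first exact: xc.
split; first exact/cvg_at_right_filter/xc.
by apply: cvgP; exact/cvg_at_left_filter/xc.
Qed.

Lemma PC_cst m n (M : 'M[K]_(m, n)) : PC tk (fun=> M).
Proof. by apply: PC_continuous => t; exact: cvg_cst. Qed.

Lemma PCD m n (x y : R -> 'M[K]_(m, n)) : PC tk x -> PC tk y ->
  PC tk (fun t => x t + y t).
Proof.
move=> [xc xk] [yc yk]; split=> [t ot|k].
  by apply: cvgD; [exact: xc|exact: yc].
have [xr /cvg_ex[lx xl]] := xk k; have [yr /cvg_ex[ly yl]] := yk k.
split; first exact: cvgD.
by apply: cvgP; exact: (cvgD xl yl).
Qed.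

Lemma PCM m n q (x : R -> 'M[K]_(m, n)) (y : R -> 'M[K]_(n, q)) :
  PC tk x -> PC tk y -> PC tk (fun t => x t *m y t).
Proof.
move=> [xc xk] [yc yk]; split=> [t ot|k].
  by apply: cvg_mulmx; [exact: xc|exact: yc].
have [xr /cvg_ex[lx xl]] := xk k; have [yr /cvg_ex[ly yl]] := yk k.
split; first exact: cvg_mulmx.
by apply: cvgP; exact: (cvg_mulmx xl yl).
Qed.

Lemma cvg_comp_gamma (zeta : int -> R) (gamma : R -> R) (F : set_system R)
    {FF : Filter F} m n (x : R -> 'M[K]_(m, n)) k :
  deviation_grid tk zeta gamma -> (\forall s \near F, tk k < s < tk (k + 1)) ->
  x (gamma s) @[s --> F] --> x (zeta k).
Proof.
move=> grid Fk; apply: (cvg_eq_near (f := fun=> x (zeta k))); last exact: cvg_cst.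
by apply: filterS Fk => s /andP[ks sk]; rewrite (gammaE grid (k := k))// sk ltW.
Qed.

Lemma PC_comp_gamma (zeta : int -> R) (gamma : R -> R) m n (x : R -> 'M[K]_(m, n)) :
  deviation_grid tk zeta gamma -> PC tk (fun t => x (gamma t)).
Proof.
move=> grid; split=> [t /(off_grid_locate grid)[k ktk]|k].
  have /andP[kt tk1] := ktk.
  rewrite /prop_for /continuous_at (gammaE grid (k := k)) ?tk1 ?(ltW kt)//.
  by apply: (cvg_comp_gamma grid); exact: near_between.
split.
  rewrite (gammaE grid (k := k)) ?lexx ?(grid_ltS grid)//.
  by apply: (cvg_comp_gamma grid); exact: (near_right_between grid).
apply: (cvgP (x (zeta (k - 1)))); rewrite -{1}(subrK 1 k).
by apply: (cvg_comp_gamma grid); exact: (near_left_between grid).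
Qed.

Lemma left_limP m n (x : R -> 'M[K]_(m, n)) k : PC tk x ->
  x @ (tk k)^'- --> left_lim x (tk k).
Proof. by move=> [_ /(_ k)[]]. Qed.

Lemma left_lim_eq m n (x : R -> 'M[K]_(m, n)) t l : x @ t^'- --> l -> left_lim x t = l.
Proof. by move=> xl; exact: cvg_lim. Qed.

End PiecewiseContinuous.

Section Embedding.
Variables (R : realType) (K : numFieldType) (emb : {rmorphism R -> K}).
Variables (co : real_coordinates emb) (tk : int -> R).

Lemma cvg_map_emb (T : Type) (F : set_system T) {FF : Filter F} m n
    (x : T -> 'M[R]_(m, n)) (a : 'M[R]_(m, n)) :
  x @ F --> a -> map_mx emb (x t) @[t --> F] --> map_mx emb a.
Proof.
move=> /cvg_mxP xa; apply/cvg_mxP => i j; rewrite mxE.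
by under eq_cvg do rewrite mxE; exact: (cvg_emb co (xa i j)).
Qed.

Lemma PC_map_emb m n (x : R -> 'M[R]_(m, n)) : PC tk x ->
  PC tk (fun t => map_mx emb (x t)).
Proof.
move=> [xc xk]; split=> [t ot|k]; first by apply: cvg_map_emb; exact: xc.
have [xr /cvg_ex[lx xl]] := xk k.
split; first exact: cvg_map_emb.
by apply: cvgP; exact: (cvg_map_emb xl).
Qed.

Lemma dq_lim_map_emb (F : set_system R) {FF : ProperFilter F} m n
    (x : R -> 'M[R]_(m, n)) (a d : 'M[R]_(m, n)) t :
  dq_lim idfun F x a t d ->
  dq_lim emb F (fun s => map_mx emb (x s)) (map_mx emb a) t (map_mx emb d).
Proof.
move=> /cvg_map_emb; apply: cvg_eq_near; apply: nearW => h.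
by rewrite /diff_quot map_mxZ fmorphV map_mxB.
Qed.

Lemma pc_deriv_map_emb m n (x dx : R -> 'M[R]_(m, n)) :
  PC tk x -> pc_deriv idfun tk x dx ->
  pc_deriv emb tk (fun t => map_mx emb (x t)) (fun t => map_mx emb (dx t)).
Proof.
move=> xPC [xd xk]; split=> [t ot|k]; first exact: (dq_lim_map_emb (xd t ot)).
have [xr [d xl]] := xk k; split; first exact: dq_lim_map_emb.
exists (map_mx emb d); rewrite /has_left_deriv.
rewrite (left_lim_eq (cvg_map_emb (left_limP (k := k) xPC))).
exact: dq_lim_map_emb xl.
Qed.

Lemma map_idfun m n (M : 'M[R]_(m, n)) : map_mx idfun M = M.
Proof. by apply/matrixP => i j; rewrite mxE. Qed.

Lemma is_solution_map_emb n m (gamma : R -> R) (A B : R -> 'M[R]_n) C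
    (x : R -> 'M[R]_(n, m)) :
  is_solution tk gamma A B C idfun x ->
  is_solution tk gamma A B C emb (fun t => map_mx emb (x t)).
Proof.
move=> [xPC xd xi]; split; first exact: PC_map_emb.
  have := pc_deriv_map_emb xPC xd.
  congr pc_deriv; apply/funext => t.
  by rewrite !map_idfun map_mxD !map_mxM.
move=> k; rewrite xi map_idfun map_mxM.
by rewrite (left_lim_eq (cvg_map_emb (left_limP (k := k) xPC))).
Qed.

Lemma pc_derivM m n q (x dx : R -> 'M[K]_(m, n)) (y dy : R -> 'M[K]_(n, q)) :
  PC tk x -> pc_deriv emb tk x dx -> (forall t, has_deriv emb y t (dy t)) ->
  pc_deriv emb tk (fun t => x t *m y t) (fun t => dx t *m y t + x t *m dy t).
Proof.
move=> xPC [xd xk] yd.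
have yc : continuous y by move=> t; exact: has_deriv_cvg (yd t).
split=> [t ot|k].
  exact: (dq_limM co (increments_dnbhs R) (xd t ot) (yd t)).
have [xr [d xl]] := xk k; split.
  apply: (dq_limM co (increments_right R) xr).
  exact: cvg_dnbhs_at_right (yd _).
exists (d *m y (tk k) + left_lim x (tk k) *m dy (tk k)); rewrite /has_left_deriv.
have yl : y @ (tk k)^'- --> y (tk k) by exact/cvg_at_left_filter/yc.
rewrite (left_lim_eq (cvg_mulmx (left_limP (k := k) xPC) yl)).
apply: (dq_limM co (increments_left R) xl).
exact: cvg_dnbhs_at_left (yd _).
Qed.

End Embedding.

(** * Uniqueness for the impulsive system *)

Section Uniqueness.
Variables (R : realType) (K : numFieldType) (emb : {rmorphism R -> K}).
Variables (co : real_coordinates emb) (n : nat).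
Variables (tk zeta : int -> R) (gamma : R -> R) (A B : R -> 'M[R]_n).
Variables (C : int -> 'M[R]_n) (Phi : R -> 'M[R]_n).
Hypothesis grid : deviation_grid tk zeta gamma.
Hypothesis transition : is_transition tk A Phi.
Hypothesis unit_impulse : forall k, 1%:M + C k \in unitmx.

Local Notation Phi_ := (fun t => map_mx emb (Phi t)).

Lemma Phi_unit t : Phi_ t \in unitmx.
Proof. by rewrite map_unitmx; case: transition. Qed.

Lemma cvg_inv_Phi t : invmx (Phi_ s) @[s --> t] --> invmx (Phi_ t).
Proof.
apply: cvg_invmx => [s||]; [exact: Phi_unit|exact: Phi_unit|].
by apply: (cvg_map_emb co); case: transition => Phic _ _ _; exact: Phic.
Qed.

(** [Phi^-1] solves the adjoint equation [Y' = - Y A], so [Phi^-1 u] has derivative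
    zero. *)
Lemma transition_const m (u : R -> 'M[K]_(n, m)) k :
  (forall t, tk k < t < tk (k + 1) -> has_deriv emb u t (map_mx emb (A t) *m u t)) ->
  forall s t, tk k < s < tk (k + 1) -> tk k < t < tk (k + 1) ->
  invmx (Phi_ s) *m u s = invmx (Phi_ t) *m u t.
Proof.
move=> ud; apply: (has_deriv0_const co (u := fun t => invmx (Phi_ t) *m u t)) => t tab.
have Phid : has_deriv emb Phi_ t (map_mx emb (A t) *m Phi_ t).
  rewrite -map_mxM; apply: (dq_lim_map_emb co); apply/has_derivE.
  have [_ + _ _] := transition; apply.
  exact: (off_grid_between grid tab).
have invd : dq_lim emb (0 : R)^' (fun s => invmx (Phi_ s)) (invmx (Phi_ t)) t
    (- (invmx (Phi_ t) *m (map_mx emb (A t) *m Phi_ t) *m invmx (Phi_ t))).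
  exact: (dq_lim_invmx co (increments_dnbhs R) Phi_unit (Phi_unit t) Phid).
have -> : 0 = - (invmx (Phi_ t) *m (map_mx emb (A t) *m Phi_ t) *m invmx (Phi_ t)) *m u t
    + invmx (Phi_ t) *m (map_mx emb (A t) *m u t).
  rewrite mulmxA -[_ *m _ *m invmx _]mulmxA mulmxV ?Phi_unit// mulmx1.
  by rewrite mulNmx mulmxA addNr.
exact: (dq_limM co (increments_dnbhs R) invd (ud t tab)).
Qed.

(** [Phi^-1 u] is constant inside the interval, and up to its ends by one-sided
    limits, so one zero is enough.  When the deviation point is the right end, the
    value given there is the one after the impulse, and the left limit vanishes
    because the impulse is injective. *)
Lemma interval_unique m (u : R -> 'M[K]_(n, m)) k :
  PC tk u ->
  (forall t, tk k < t < tk (k + 1) -> has_deriv emb u t (map_mx emb (A t) *m u t)) ->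
  u (tk (k + 1)) = map_mx emb (1%:M + C (k + 1)) *m left_lim u (tk (k + 1)) ->
  u (zeta k) = 0 ->
  forall t, tk k <= t < tk (k + 1) -> u t = 0.
Proof.
move=> uPC ud ui u0; pose v t := invmx (Phi_ t) *m u t.
have [_ ucond] := uPC.
have [_ _ _ /(_ k)/andP[kz zk] _] := grid.
pose mid := (tk k + tk (k + 1)) / 2.
have mid_in : tk k < mid < tk (k + 1) by rewrite !midf_lt ?(grid_ltS grid).
have vE t : tk k < t < tk (k + 1) -> v t = v mid.
  by move=> tab; exact: (transition_const ud tab mid_in).
have vr : v (tk k) = v mid.
  have c1 : v @ (tk k)^'+ --> v (tk k).
    apply: cvg_mulmx; last exact: (ucond k).1.
    exact/cvg_at_right_filter/cvg_inv_Phi.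
  have c2 : v @ (tk k)^'+ --> v mid.
    apply: (cvg_eq_near (f := fun=> v mid)); last exact: cvg_cst.
    by apply: filterS (near_right_between grid k) => s /vE.
  by rewrite -(cvg_lim _ c1)// -(cvg_lim _ c2).
have vE' t : tk k <= t < tk (k + 1) -> v t = v mid.
  rewrite le_eqVlt => /andP[/orP[/eqP <-//|kt] tk1]; apply: vE.
  by rewrite kt.
have v0 : v mid = 0.
  move: zk; rewrite le_eqVlt => /orP[/eqP zk|zk]; last first.
    by rewrite -(vE' (zeta k)) ?kz// /v u0 mulmx0.
  have ul0 : left_lim u (tk (k + 1)) = 0.
    have Cu : map_mx emb (1%:M + C (k + 1)) \in unitmx by rewrite map_unitmx.
    rewrite -[LHS](mulKmx Cu).
    by rewrite -ui -zk u0 mulmx0.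
  have c1 : v @ (tk (k + 1))^'- --> invmx (Phi_ (tk (k + 1))) *m left_lim u (tk (k + 1)).
    apply: cvg_mulmx; last exact: (left_limP (k := k + 1) uPC).
    exact/cvg_at_left_filter/cvg_inv_Phi.
  have c2 : v @ (tk (k + 1))^'- --> v mid.
    apply: (cvg_eq_near (f := fun=> v mid)); last exact: cvg_cst.
    by apply: filterS (near_left_between grid k) => s /vE.
  by rewrite -(cvg_lim _ c2)// (cvg_lim _ c1)// ul0 mulmx0.
by move=> t tab; rewrite -[LHS](mulKVmx (Phi_unit t)) -/(v t) vE'// v0 mulmx0.
Qed.

Variable X : R -> 'M[R]_n.
Hypothesis X_fundamental : is_fundamental tk gamma A B C X.

Local Notation X_ := (fun t => map_mx emb (X t)).

(** On each interval, the multiple of [X] with the same value at the deviation point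
    is subtracted and [interval_unique] applies; the impulses carry the constant
    from an interval to the next one. *)
Lemma solutionE m (x : R -> 'M[K]_(n, m)) :
  is_solution tk gamma A B C emb x ->
  exists c : 'M[K]_(n, m), forall t, x t = X_ t *m c.
Proof.
move=> [xPC xd xi].
have [/(is_solution_map_emb co)[XPC Xd Xi] Xu] := X_fundamental.
have X_unit t : X_ t \in unitmx by rewrite map_unitmx.
pose c k := invmx (X_ (zeta k)) *m x (zeta k).
have XcE k : map_mx emb (X (zeta k)) *m c k = x (zeta k).
  by rewrite /c mulKVmx// X_unit.
have xE k t : tk k <= t < tk (k + 1) -> x t = X_ t *m c k.
  move=> tab; apply/eqP; rewrite -subr_eq0; apply/eqP.
  pose u s := x s + X_ s *m - c k.
  have XcPC : PC tk (fun s => X_ s *m - c k) by apply: PCM XPC _; exact: PC_cst.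
  have uPC : PC tk u by exact: PCD.
  have <- : u t = x t - X_ t *m c k by rewrite /u mulmxN.
  apply: (interval_unique uPC _ _ _ tab).
  - move=> s sab; have os := off_grid_between grid sab.
    have gs : gamma s = zeta k by apply: (gammaE grid); case/andP: sab => /ltW -> ->.
    have cC : dq_lim emb (0 : R)^' (fun=> - c k) (- c k) s 0 by exact: dq_lim_cst.
    have -> : map_mx emb (A s) *m u s =
        map_mx emb (A s) *m x s + map_mx emb (B s) *m x (gamma s) +
        ((map_mx emb (A s) *m X_ s + map_mx emb (B s) *m X_ (gamma s)) *m - c k
         + X_ s *m 0); last first.
      exact: (dq_limD (xd.1 s os) (dq_limM co (increments_dnbhs R) (Xd.1 s os) cC)).
    rewrite gs /u mulmx0 addr0 mulmxDr mulmxDl -!mulmxA !mulmxN /= XcE.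
    by rewrite addrACA subrr addr0.
  - rewrite /u xi Xi; have xl := left_limP (k := k + 1) xPC.
    have cC : (fun=> - c k) @ (tk (k + 1))^'- --> - c k by exact: cvg_cst.
    have Xl : X_ s *m - c k @[s --> (tk (k + 1))^'-] -->
        left_lim X_ (tk (k + 1)) *m - c k.
      exact: (cvg_mulmx (left_limP (k := k + 1) XPC) cC).
    by rewrite (left_lim_eq (cvgD xl Xl)) mulmxDr mulmxA.
  - by rewrite /u mulmxN XcE subrr.
have cS k : c (k + 1) = c k.
  have xl := left_limP (k := k + 1) xPC.
  have cC : (fun=> c k) @ (tk (k + 1))^'- --> c k by exact: cvg_cst.
  have Xl : x @ (tk (k + 1))^'- --> left_lim X_ (tk (k + 1)) *m c k.
    apply: (cvg_eq_near _ (cvg_mulmx (left_limP (k := k + 1) XPC) cC)).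
    apply: filterS (near_left_between grid k) => s /andP[ks sk].
    by rewrite (xE k)// sk ltW.
  have x1 : x (tk (k + 1)) = X_ (tk (k + 1)) *m c k.
    by rewrite xi Xi (left_lim_eq Xl) mulmxA.
  rewrite (xE (k + 1)) ?lexx ?(grid_ltS grid)// in x1.
  by rewrite -[LHS](mulKmx (X_unit (tk (k + 1)))) x1 mulKmx.
have c0 k : c k = c 0.
  elim/int_rect: k => [//|k IH|k IH]; first by rewrite -addn1 PoszD cS.
  by rewrite -IH -(cS (- (k.+1)%:Z)) -addn1 PoszD opprD subrK.
exists (c 0) => t; have [k kt] := grid_locate grid t.
by rewrite (xE k)// c0.
Qed.

End Uniqueness.

Lemma periodic_impulse_unit (R : realType) n (C : int -> 'M[R]_n) (p : nat) :
  (0 < p)%N -> (forall k : nat, (1 <= k <= p)%N -> \det (1%:M + C k%:Z) != 0) ->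
  (forall k, C (k + p%:Z) = C k) -> forall k, 1%:M + C k \in unitmx.
Proof.
move=> p0 Cdet Cp.
have Cnat k (m : nat) : C (k + m%:Z * p%:Z) = C k.
  elim: m => [|m IH]; first by rewrite mul0r addr0.
  by rewrite -addn1 PoszD mulrDl mul1r addrA Cp IH.
have Cint k (m : int) : C (k + m * p%:Z) = C k.
  case: m => m; first exact: Cnat.
  by rewrite -(Cnat (k + _) m.+1) NegzE -addrA -mulrDl addNr mul0r addr0.
move=> k; have pz : p%:Z != 0 by rewrite eqz_nat -lt0n.
(* The shift by [1] moves the residues to [1], ..., [p]. *)
have kE : k = ((k - 1) %% p%:Z)%Z + 1 + ((k - 1) %/ p%:Z)%Z * p%:Z.
  by rewrite addrAC [_ + _ * _]addrC -divz_eq subrK.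
have r0 := modz_ge0 (k - 1) pz.
have rp := ltz_pmod (k - 1) (p0 : 0 < p%:Z).
rewrite kE Cint unitmxE unitfE.
move: r0 rp; case: ((k - 1) %% p%:Z)%Z => // r _ rp.
have -> : (r%:Z + 1 = r.+1%:Z)%R by rewrite -addn1 PoszD.
by apply: Cdet; rewrite /= -ltz_nat.
Qed.

(** * Boundedness of periodic piecewise continuous functions *)

Section Bounded.
Variables (R : realType) (K : numFieldType) (emb : {rmorphism R -> K}).
Variables (co : real_coordinates emb) (n : nat).
Variables (tk zeta : int -> R) (gamma : R -> R).
Hypothesis grid : deviation_grid tk zeta gamma.

Lemma PC_locally_bounded (x : R -> 'M[K]_n) (t : R) : PC tk x ->
  exists c, \forall s \near t, row_bounded emb c (x s).
Proof.
move=> [xc xk].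
have [[k tE]|ot] := pselect (exists k, t = tk k); last first.
  have [k tk' | c _ xb] := row_bounded_near co (xc t _); last by exists c.
  by apply: ot; exists k.
have [/(row_bounded_near co)[cr _ br] /cvg_ex[l /(row_bounded_near co)[cl _ bl]]] := xk k.
have [c0 _ b0] := row_bounded_ex co (x t).
exists (Num.max c0 (Num.max cl cr)); rewrite -tE in br bl.
have {}bl : \forall s \near t, s < t -> row_bounded emb cl (x s) by exact: bl.
have {}br : \forall s \near t, t < s -> row_bounded emb cr (x s) by exact: br.
near=> s; have [st|ts|->] := ltgtP s t.
- apply: (row_bounded_le co (c := cl)); first by rewrite !le_max lexx orbT.
  by move: st; near: s.
- apply: (row_bounded_le co (c := cr)); first by rewrite !le_max lexx !orbT.
  by move: ts; near: s.
- by apply: (row_bounded_le co _ b0); rewrite le_max lexx.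
Unshelve. all: by end_near. Qed.

(** Local bounds come from the one-sided limits; they are made uniform over one
    period by compactness. *)
Lemma PC_periodic_bounded (x : R -> 'M[K]_n) w : 0 < w -> PC tk x ->
  (forall t, x (t + w) = x t) ->
  exists c, forall t i j, `|x t i j| <= emb c.
Proof.
move=> w0 xPC xw.
have /compact_near_coveringP cover := @segment_compact R 0 w.
have [c cb] : exists c, forall t, 0 <= t <= w -> row_bounded emb c (x t).
  have : \forall c \near +oo, `[0, w] `<=` (fun t => row_bounded emb c (x t)).
    apply: cover => t _; have [c0 xb] := PC_locally_bounded t xPC.
    exists ([set s | row_bounded emb c0 (x s)], [set c | c0 <= c]) => /=.
      by split => //; exact: (nbhs_pinfty_ge (num_real c0)).
    by move=> [s c] /= [sb c0c]; exact: (row_bounded_le co c0c sb).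
  move=> /(filter_ex (F := +oo)) [c cb]; exists c => t tw; apply: cb.
  by rewrite /= in_itv.
have xnat t (m : nat) : x (t + m%:R * w) = x t.
  elim: m => [|m IH]; first by rewrite mul0r addr0.
  by rewrite -addn1 natrD mulrDl mul1r addrA xw IH.
have xint t (m : int) : x (t + m%:~R * w) = x t.
  case: m => m; first exact: xnat.
  by rewrite -(xnat (t + _) m.+1) NegzE mulrNz -addrA mulNr addNr addr0.
exists c => t i j; apply: row_bounded_entry.
rewrite -(xint t (- Num.floor (t / w))); apply: cb.
have := floor_itv (t / w); rewrite ler_pdivlMr// ltr_pdivrMr// => /andP[].
rewrite intrD mulrDl mul1r => fl fr.
by rewrite mulrNz mulNr subr_ge0 fl /= lerBlDl ltW.
Qed.

End Bounded.

(** * Floquet normal forms *)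

Section ExponentialFlow.
Variables (R : realType) (K : numFieldType) (emb : {rmorphism R -> K}).
Variables (co : real_coordinates emb) (n : nat) (P : 'M[K]_n).

Definition flow t : 'M[K]_n := expmx (emb t *: P).

Lemma flow_deriv t : has_deriv emb flow t (flow t *m P).
Proof.
have Pd : dq_lim emb (0 : R)^' (fun s => emb s *: P) (emb t *: P) t P.
exact: (dq_lim_scale emb (increments_dnbhs R)).
apply: (dq_lim_expmx co (increments_dnbhs R) _ Pd).
by apply: nearW => h; rewrite -!scalemxAl -!scalemxAr !scalerA mulrC.
Qed.

Lemma flow_continuous : continuous flow.
Proof. by move=> t; exact: (has_deriv_cvg co (@flow_deriv t)). Qed.

Lemma flowD s t : flow (s + t) = flow s *m flow t.
Proof.
rewrite /flow -(expmxD co) -?scalerDl -?rmorphD//.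
by rewrite -!scalemxAl -!scalemxAr !scalerA mulrC.
Qed.

Lemma flow0 : flow 0 = 1%:M.
Proof. by rewrite /flow rmorph0 scale0r (expmx0 co). Qed.

Lemma flowN t : flow (- t) *m flow t = 1%:M.
Proof. by rewrite -flowD addNr flow0. Qed.

Lemma flow_unit t : flow t \in unitmx.
Proof. exact: (expmx_unit co). Qed.

Lemma flow_comm t : flow t *m P = P *m flow t.
Proof. by apply: (expmx_comm co); rewrite -scalemxAl -scalemxAr. Qed.

End ExponentialFlow.

Arguments flow_deriv {R K emb} co {n} P t.

Section FloquetForm.
Variables (R : realType) (K : numFieldType) (emb : {rmorphism R -> K}).
Variables (co : real_coordinates emb) (n : nat).
Variables (tk zeta : int -> R) (gamma : R -> R) (A B : R -> 'M[R]_n).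
Variables (C : int -> 'M[R]_n).
Hypothesis grid : deviation_grid tk zeta gamma.

Local Notation A_ := (fun t => map_mx emb (A t)).
Local Notation B_ := (fun t => map_mx emb (B t)).

Lemma flow_opp (P : 'M[K]_n) t : flow emb (- P) t = flow emb P (- t).
Proof. by rewrite /flow scalerN rmorphN scaleNr. Qed.

(** Periodic as soon as [expmx (w P)] is the monodromy matrix of [Y]. *)
Definition floquet_factor (P : 'M[K]_n) (Y : R -> 'M[K]_n) t := Y t *m flow emb (- P) t.

Lemma floquet_factorK P Y t : Y t = floquet_factor P Y t *m flow emb P t.
Proof. by rewrite /floquet_factor flow_opp -mulmxA (flowN co) mulmx1. Qed.

Lemma floquet_factor_periodic (w : R) (P M : 'M[K]_n) Y t : w != 0 ->
  expmx (emb w *: P) = M -> (forall t, Y (t + w) = Y t *m M) ->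
  floquet_factor P Y (t + w) = floquet_factor P Y t.
Proof.
move=> w0 PM YM; rewrite /floquet_factor YM [t + w]addrC flowD// mulmxA.
rewrite -[_ *m M *m _]mulmxA -PM -/(flow emb P w) flow_opp.
by have := flowN co P (- w); rewrite opprK => ->; rewrite mulmx1.
Qed.

Variables (P : 'M[K]_n) (Y : R -> 'M[K]_n).
Hypothesis Y_solution : is_solution tk gamma A B C emb Y.
Local Notation Q := (floquet_factor P Y).

Lemma floquet_factor_PC : PC tk Q.
Proof.
case: Y_solution => YPC _ _; apply: PCM YPC _; apply: PC_continuous.
exact: flow_continuous.
Qed.

Definition floquet_factor_deriv t :=
  (A_ t *m Y t + B_ t *m Y (gamma t)) *m flow emb (- P) t
  + Y t *m (flow emb (- P) t *m - P).

Lemma floquet_factor_pc_deriv : pc_deriv emb tk Q floquet_factor_deriv.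
Proof.
by case: Y_solution => YPC Yd _; apply: (pc_derivM co) => // t; exact: flow_deriv.
Qed.

Lemma floquet_factor_PC1 : PC tk A -> PC tk B -> PC1 emb tk Q.
Proof.
move=> APC BPC; exists floquet_factor_deriv; first exact: floquet_factor_pc_deriv.
have [YPC _ _] := Y_solution.
have flowPC : PC tk (flow emb (- P)) by apply: PC_continuous; exact: flow_continuous.
have PPC : PC tk (fun=> - P : 'M[K]_n) by exact: PC_cst.
have YgPC : PC tk (fun t => Y (gamma t)) by exact: PC_comp_gamma grid.
have AYPC := PCM (PC_map_emb co APC) YPC.
have BYPC := PCM (PC_map_emb co BPC) YgPC.
exact: (PCD (PCM (PCD AYPC BYPC) flowPC) (PCM YPC (PCM flowPC PPC))).
Qed.

Lemma floquet_factor_equation t : off_grid tk t ->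
  has_deriv emb Q t
    (A_ t *m Q t - Q t *m P + B_ t *m Q (gamma t) *m expmx (emb (gamma t - t) *: P)).
Proof.
move=> ot; have := floquet_factor_pc_deriv.1 t ot.
congr (has_deriv _ _ _ _).
rewrite -/(flow emb P (gamma t - t)) /floquet_factor_deriv /floquet_factor.
rewrite -[B_ t *m _ *m _]mulmxA -[Y (gamma t) *m _ *m _]mulmxA !flow_opp -flowD//.
by rewrite addKr mulmxDl mulmxN mulmxN !mulmxA addrAC.
Qed.

Lemma floquet_factor_impulse k :
  Q (tk k) = map_mx emb (1%:M + C k) *m left_lim Q (tk k).
Proof.
have [YPC _ Yi] := Y_solution.
have fl : flow emb (- P) @ (tk k)^'- --> flow emb (- P) (tk k).
  exact/cvg_at_left_filter/flow_continuous.
by rewrite (left_lim_eq (cvg_mulmx (left_limP (k := k) YPC) fl)) mulmxA -Yi.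
Qed.

Lemma floquet_factor_unit t : Y t \in unitmx -> Q t \in unitmx.
Proof. by move=> Yu; rewrite unitmx_mul Yu flow_unit. Qed.

Lemma is_solution_mulr m (c : 'M[K]_(n, m)) :
  is_solution tk gamma A B C emb (fun t => Y t *m c).
Proof.
have [YPC Yd Yi] := Y_solution.
have cd t : has_deriv emb (fun=> c) t 0 by exact: dq_lim_cst.
split; first by apply: PCM YPC _; exact: PC_cst.
  have := pc_derivM co YPC Yd cd; congr pc_deriv; apply/funext => t.
  by rewrite mulmx0 addr0 mulmxDl !mulmxA.
move=> k; have cC : (fun=> c) @ (tk k)^'- --> c by exact: cvg_cst.
by rewrite (left_lim_eq (cvg_mulmx (left_limP (k := k) YPC) cC)) mulmxA -Yi.
Qed.

Lemma linear_ode_solution m (Z : R -> 'M[K]_(n, m)) :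
  (forall t, has_deriv emb Z t (P *m Z t)) <->
  exists c, forall t, Z t = flow emb P t *m c.
Proof.
split=> [Zd|[c Zc] t].
  exists (Z 0) => t; pose u s := flow emb (- P) s *m Z s.
  have ud s : - `|t| - 1 < s < `|t| + 1 -> has_deriv emb u s 0.
    move=> _; have -> : 0 = (flow emb (- P) s *m - P) *m Z s
        + flow emb (- P) s *m (P *m Z s).
      by rewrite mulmxN mulNmx mulmxA addNr.
    exact: (dq_limM co (increments_dnbhs R) (flow_deriv co (- P) s) (Zd s)).
  have t_in : - `|t| - 1 < t < `|t| + 1.
    have := ler_norm t; have := ler_norm (- t); rewrite normrN => tN tp.
    by apply/andP; split; lra.
  have o_in : - `|t| - 1 < 0 < `|t| + 1.
    by have := normr_ge0 t => tp; apply/andP; split; lra.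
  have := has_deriv0_const co ud t_in o_in; rewrite /u (flow0 co) mul1mx => <-.
  by rewrite mulmxA flow_opp -[X in X *m _]flowD// subrr (flow0 co) mul1mx.
have cd : has_deriv emb (fun=> c) t 0 by exact: dq_lim_cst.
have -> : P *m Z t = flow emb P t *m P *m c + flow emb P t *m 0.
  by rewrite mulmx0 addr0 (flow_comm co) -mulmxA -Zc.
have -> : Z = (fun s => flow emb P s *m c) by exact/funext.
exact: (dq_limM co (increments_dnbhs R) (flow_deriv co P t) cd).
Qed.

End FloquetForm.

(** * The normal forms of the periodic system *)

Section Conclusion.
Variables (R : realType) (n : nat).
Variables (tk zeta : int -> R) (gamma : R -> R) (A B : R -> 'M[R]_n).
Variables (C : int -> 'M[R]_n) (w : R).
Hypothesis grid : deviation_grid tk zeta gamma.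
Hypotheses (APC : PC tk A) (BPC : PC tk B) (w0 : 0 < w).

(** Over two periods a solution is multiplied by [M ^ 2], which has a real
    logarithm even when [M] has none. *)
Lemma real_floquet_formP (Y : R -> 'M[R]_n) (M : 'M[R]_n) :
  is_fundamental tk gamma A B C Y -> M \in unitmx ->
  (forall t, Y (t + w) = Y t *m M) -> real_floquet_form tk w Y M.
Proof.
move=> [Ysol Yu] Mu YM; have co := self_coordinates R.
have w20 : 2 * w != 0 by rewrite mulf_neq0// ?pnatr_eq0// gt_eqF.
split; first exact: real_logarithm_sqr.
move=> L LM P; exists (floquet_factor (@idfun R : {rmorphism R -> R}) P Y); split.
- by move=> t; exact: (floquet_factorK co).
- exact: (floquet_factor_PC1 co grid P Ysol APC BPC).
- by move=> t; exact: (floquet_factor_unit co).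
- have Pw : expmx ((idfun : {rmorphism R -> R}) (2 * w) *: P) = M *m M.
    rewrite /P scalerA (divff w20) scale1r; exact: LM.
  have YM2 t : Y (t + 2 * w) = Y t *m (M *m M).
    by rewrite mulr_natl mulr2n addrA !YM mulmxA.
  by move=> t; exact: (floquet_factor_periodic co t w20 Pw YM2).
Qed.

Variables (Phi X : R -> 'M[R]_n).
Hypothesis transition : is_transition tk A Phi.
Hypothesis unit_impulse : forall k, 1%:M + C k \in unitmx.
Hypothesis X_fundamental : is_fundamental tk gamma A B C X.
Hypothesis X_monodromy : forall t, X (t + w) = X t *m X w.

Let co := complex_coordinates R.
Let cemb : {rmorphism R -> R[i]} := real_complex R.

Lemma cX_solution : is_solution tk gamma A B C cemb (fun t => cmx (X t)).
Proof. by apply: (is_solution_map_emb co); case: X_fundamental. Qed.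

(** [Q] is [X] followed by the flow of [- P].  Hence [Q Y] solves the system if and
    only if [Q Y = X c] for a constant [c], by uniqueness, that is [Y = exp (t P) c],
    which are the solutions of [Y' = P Y]. *)
Lemma complex_floquet_formP (L : 'M[R[i]]_n) :
  is_mxlog (cmx (X w)) L ->
  let P := real_complex R w^-1 *: L in
  let Q := floquet_factor cemb P (fun t => cmx (X t)) in
  [/\ complex_floquet_form tk gamma A B C w X P Q,
      reducible_by tk gamma A B C P Q &
      kinematically_similar_by tk gamma A B P Q].
Proof.
move=> LX P Q; have Xsol := cX_solution.
have Qu t : Q t \in unitmx.
  by apply: (floquet_factor_unit co); rewrite map_unitmx; case: X_fundamental.
have wP : expmx (cemb w *: P) = cmx (X w).
  have wV : real_complex R w^-1 = (cemb w)^-1 by exact: (fmorphV cemb).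
  have cw0 : cemb w != 0 by rewrite fmorph_eq0 gt_eqF.
  rewrite /P wV scalerA (divff cw0) scale1r; exact: LX.
have Qw : forall t, Q (t + w) = Q t.
  move=> t.
  have XM s : cmx (X (s + w)) = cmx (X s) *m cmx (X w).
    by rewrite X_monodromy; exact: map_mxM.
  have wN0 : w != 0 by rewrite gt_eqF.
  exact: (floquet_factor_periodic co t wN0 wP XM).
have Qeq : Q_equation tk gamma A B P Q.
  by move=> t ot; exact: (floquet_factor_equation co Xsol ot).
split.
- split; first by move=> t; exact: (floquet_factorK co).
  split; [|exact: Qu|exact: Qw|exact: Qeq|].
    exact: (floquet_factor_PC1 co grid P Xsol APC BPC).
  by move=> k; exact: (floquet_factor_impulse co P Xsol).
- split; first exact: Qu.
  move=> m Y; split=> [Qsol|Yd].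
    have [c YE] := solutionE co grid transition unit_impulse X_fundamental Qsol.
    apply/(linear_ode_solution co P Y); exists c => t.
    have QY : Q t *m Y t = Q t *m flow cemb P t *m c.
      by rewrite -(floquet_factorK co P (fun t => cmx (X t)) t); exact: YE.
    by rewrite -[LHS](mulKmx (Qu t)) QY -mulmxA (mulKmx (Qu t)).
  have /(linear_ode_solution co P Y)[c YE] := Yd.
  have -> : (fun t => Q t *m Y t) = (fun t => cmx (X t) *m c).
    apply/funext => t; rewrite YE mulmxA; congr (_ *m _).
    exact/esym/(floquet_factorK co P (fun t => cmx (X t))).
  exact: (is_solution_mulr co Xsol).
split; last exact: Qeq.
split; first exact: Qu.
- have [c Qc] := PC_periodic_bounded co w0 (floquet_factor_PC co P Xsol) Qw.
  by exists c; exact: Qc.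
- by move=> t ot; eexists; exact: Qeq ot.
Qed.

(** Another fundamental solution is [X Y(0)]; its monodromy is conjugate to that
    of [X]. *)
Lemma fundamental_monodromy (Y : R -> 'M[R]_n) : X 0 = 1%:M ->
  is_fundamental tk gamma A B C Y ->
  forall t, Y (t + w) = Y t *m (invmx (Y 0) *m Y w).
Proof.
move=> X0 [Ysol Yu] t.
have [c] := solutionE (self_coordinates R) grid transition unit_impulse
  X_fundamental Ysol.
move=> YE; have Y0 : Y 0 = c by rewrite YE map_idfun X0 mul1mx.
have {}YE s : Y s = X s *m Y 0 by rewrite YE map_idfun Y0.
by rewrite YE X_monodromy [Y t]YE -[X t *m Y 0 *m _]mulmxA mulKVmx// (YE w) mulmxA.
Qed.

End Conclusion.

Theorem theorem7 (R : realType) (n p : nat) (w : R)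
    (tk zeta : int -> R) (gamma : R -> R)
    (A B : R -> 'M[R]_n) (C : int -> 'M[R]_n)
    (N : 'M[R]_n -> R) (Phi X : R -> 'M[R]_n) :
  0 < w ->
  deviation_grid tk zeta gamma ->
  tk 0 = 0 -> tk p%:Z <= w ->
  PC tk A -> PC tk B -> loc_integrable_mx A -> loc_integrable_mx B ->
  (forall k : nat, (1 <= k <= p)%N -> \det (1%:M + C k%:Z) != 0) ->
  periodic_data tk zeta A B C w p ->
  is_matrix_norm N -> hyp_H tk zeta A B N ->
  is_transition tk A Phi -> biperiodic B Phi w ->
  is_fundamental tk gamma A B C X -> X 0 = 1%:M ->
  (forall t, X (t + w) = X t *m X w) ->
  \det (X w) != 0 ->
  (* complex Floquet form (i) and reducibility (ii), for any Log(X(w)) *)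
  ((exists L : 'M[R[i]]_n, is_mxlog (cmx (X w)) L) /\
   (forall L : 'M[R[i]]_n, is_mxlog (cmx (X w)) L ->
      let P := real_complex R w^-1 *: L in
      exists Q : R -> 'M[R[i]]_n,
        [/\ complex_floquet_form tk gamma A B C w X P Q,
            reducible_by tk gamma A B C P Q &
            kinematically_similar_by tk gamma A B P Q])) /\
  (* real Floquet form (i), for X and for every fundamental solution *)
  (real_floquet_form tk w X (X w) /\
   (forall Y : R -> 'M[R]_n, is_fundamental tk gamma A B C Y ->
      real_floquet_form tk w Y (invmx (Y 0) *m Y w))).
Proof.
move=> w0 grid tk0 _ APC BPC _ _ Cdet [_ _ Cp tkp _] _ _ transition _ Xfund X0 Xw _.
have p0 : (0 < p)%N.
  rewrite lt0n; apply: contraTneq w0 => p0.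
  have := tkp 0; rewrite p0 addr0 => /eqP.
  by rewrite -subr_eq0 opprD addrA subrr add0r oppr_eq0 => /eqP ->; rewrite ltxx.
have Cu := periodic_impulse_unit p0 Cdet Cp.
have Xwu : X w \in unitmx by case: Xfund.
split; last split.
- split.
    have cXu : cmx (X w) \in unitmx by rewrite map_unitmx.
    by have [L LX _] := complex_logarithm cXu; exists L.
  move=> L LX P; eexists.
  exact: (complex_floquet_formP grid APC BPC w0 transition Cu Xfund Xw LX).
- exact: (real_floquet_formP grid APC BPC w0 Xfund Xwu Xw).
move=> Y Yfund; have Yu := Yfund.2.
have Mu : invmx (Y 0) *m Y w \in unitmx by rewrite unitmx_mul unitmx_inv !Yu.
apply: (real_floquet_formP grid APC BPC w0 Yfund Mu).
exact: (fundamental_monodromy grid transition Cu Xfund Xw X0 Yfund).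
Qed.
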